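(* Let $\Bbbk$ be a field, let $Q$ be the quiver with three vertices $1,2,3$, arrows $a_1,a_2\colon 1\to2$ and $b_1,b_2\colon2\to3$, and relations $b_2a_1=0$ and $b_1a_2=0$, and let $\mathrm{D^b}(Q)=\mathrm{D^b}(\mathrm{Rep}(Q))$ be the bounded derived category of finite-dimensional representations of $Q$ over $\Bbbk$. Let $E_+,E_-\in\mathrm{Rep}(Q)$ be the representations with $\Bbbk$ at each vertex and $$E_+:\ a_1=b_1=1,\ a_2=b_2=0;\qquad E_-:\ a_1=b_1=0,\ a_2=b_2=1.$$ These are exceptional objects of $\mathrm{D^b}(Q)$; let $\mathscr{C}_{\pm}\subset\mathrm{D^b}(Q)$ be the components defined by the semiorthogonal decompositions $$\mathrm{D^b}(Q)=\langle E_+,\mathscr{C}_+\rangle=\langle E_-,\mathscr{C}_-\rangle.$$ Then the standard t-structure on $\mathrm{D^b}(Q)$ connectively induces a bounded t-structure on the semiorthogonal components $\mathscr{C}_+$ and $\mathscr{C}_-$.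
   Context: Explicitly, $\mathscr{C}_{\pm}=\{D\in\mathrm{D^b}(Q):\mathrm{Hom}(D,E_{\pm}[n])=0\text{ for all }n\in\mathbf{Z}\}$; in the semiorthogonal decompositions $E_\pm$ stands for the triangulated subcategory it generates. A t-structure $\tau=(\mathscr{D}^{\le0},\mathscr{D}^{\ge0})$ on $\mathscr{D}$ connectively induces a t-structure on a full triangulated subcategory $\mathscr{C}\subset\mathscr{D}$ if the pair $(\mathscr{C}^{\le 0},\mathscr{C}^{\ge 0})$ with $\mathscr{C}^{\le 0}=\mathscr{D}^{\le 0}\cap\mathscr{C}$ and $\mathscr{C}^{\ge 0}=\{C\in\mathscr{C}:\mathrm{Hom}(C'[1],C)=0\ \forall C'\in\mathscr{C}^{\le 0}\}$ is a t-structure on $\mathscr{C}$ (called the connectively induced t-structure). A t-structure is bounded if every object lies in $\mathscr{D}^{\ge 0}[-a]\cap\mathscr{D}^{\le 0}[-b]$ for some $a,b\in\mathbf{Z}$. *)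

(* Defs.v *)
From HB Require Import structures.
From mathcomp Require Import all_boot all_order all_algebra.

Set Implicit Arguments.
Unset Strict Implicit.
Unset Printing Implicit Defensive.

Import Order.TTheory GRing.Theory Num.Theory.
Local Open Scope ring_scope.

Definition lfst (k : fieldType) (V W : vectType k) : 'Hom((V * W)%type, V) :=
  linfun fst.
Definition lsnd (k : fieldType) (V W : vectType k) : 'Hom((V * W)%type, W) :=
  linfun snd.

Definition pair_fun (k : fieldType) (U V W : vectType k)
  (f : 'Hom(U, V)) (g : 'Hom(U, W)) : U -> (V * W)%type :=
  fun u => (f u, g u).

Lemma pair_fun_is_linear (k : fieldType) (U V W : vectType k)
  (f : 'Hom(U, V)) (g : 'Hom(U, W)) : linear (pair_fun f g).
Proof. by move=> a u v; rewrite /pair_fun !linearP. Qed.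

HB.instance Definition _ (k : fieldType) (U V W : vectType k)
  (f : 'Hom(U, V)) (g : 'Hom(U, W)) :=
  GRing.isLinear.Build k U (V * W)%type *:%R (pair_fun f g)
    (pair_fun_is_linear f g).

Definition lpair (k : fieldType) (U V W : vectType k)
  (f : 'Hom(U, V)) (g : 'Hom(U, W)) : 'Hom(U, (V * W)%type) :=
  linfun (pair_fun f g).

Lemma lfstE (k : fieldType) (V W : vectType k) (x : (V * W)%type) :
  lfst V W x = x.1.
Proof. exact: lfunE. Qed.

Lemma lsndE (k : fieldType) (V W : vectType k) (x : (V * W)%type) :
  lsnd V W x = x.2.
Proof. exact: lfunE. Qed.

Lemma lpairE (k : fieldType) (U V W : vectType k)
  (f : 'Hom(U, V)) (g : 'Hom(U, W)) (u : U) : lpair f g u = (f u, g u).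
Proof. exact: (lfunE (pair_fun f g)). Qed.

Inductive vertex := v1 | v2 | v3.
Inductive arrow := a1 | a2 | b1 | b2.

Definition src (al : arrow) : vertex :=
  match al with a1 | a2 => v1 | b1 | b2 => v2 end.
Definition tgt (al : arrow) : vertex :=
  match al with a1 | a2 => v2 | b1 | b2 => v3 end.

Record rep (k : fieldType) := Rep {
  sp :> vertex -> vectType k;
  act : forall al : arrow, 'Hom(sp (src al), sp (tgt al));
  rel_b2a1 : (act b2 \o act a1)%VF = 0;
  rel_b1a2 : (act b1 \o act a2)%VF = 0
}.

Record rhom (k : fieldType) (M N : rep k) := RHom {
  rmap :> forall v : vertex, 'Hom(M v, N v);
  rmapP : forall al : arrow,
    (rmap (tgt al) \o act M al)%VF = (act N al \o rmap (src al))%VF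
}.

Section RepCategory.

Variable k : fieldType.

Lemma rmapE (M N : rep k) (f : rhom M N) (al : arrow) x :
  f (tgt al) (act M al x) = act N al (f (src al) x).
Proof. by rewrite -!comp_lfunE rmapP. Qed.

Lemma rel_b2a1E (M : rep k) x : act M b2 (act M a1 x) = 0.
Proof. by rewrite -comp_lfunE rel_b2a1 zero_lfunE. Qed.

Lemma rel_b1a2E (M : rep k) x : act M b1 (act M a2 x) = 0.
Proof. by rewrite -comp_lfunE rel_b1a2 zero_lfunE. Qed.

Definition rid (M : rep k) : rhom M M.
Proof.
by refine (@RHom k M M (fun v => \1%VF) _) => al; rewrite comp_lfun1l comp_lfun1r.
Defined.

Definition rcomp (L M N : rep k) (g : rhom M N) (f : rhom L M) : rhom L N.
Proof.
refine (@RHom k L N (fun v => (g v \o f v)%VF) _) => al.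
by apply/lfunP=> x; rewrite !comp_lfunE !rmapE.
Defined.

Definition rzero (M N : rep k) : rhom M N.
Proof.
by refine (@RHom k M N (fun v => 0) _) => al; rewrite comp_lfun0l comp_lfun0r.
Defined.

Definition radd (M N : rep k) (f g : rhom M N) : rhom M N.
Proof.
refine (@RHom k M N (fun v => f v + g v) _) => al.
by rewrite comp_lfunDl comp_lfunDr !rmapP.
Defined.

Definition rscale (c : k) (M N : rep k) (f : rhom M N) : rhom M N.
Proof.
refine (@RHom k M N (fun v => c *: f v) _) => al.
by rewrite -comp_lfunZl -comp_lfunZr rmapP.
Defined.

Definition rep0 : rep k.
Proof.
by refine (@Rep k (fun v => 'rV[k]_0) (fun al => 0) _ _); rewrite comp_lfun0l.
Defined.

Definition rsum (M N : rep k) : rep k.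
Proof.
refine (@Rep k (fun v => (M v * N v)%type)
  (fun al => lpair (act M al \o lfst _ _) (act N al \o lsnd _ _)) _ _);
  apply/lfunP=> x; rewrite comp_lfunE !lpairE !comp_lfunE !(lfstE, lsndE) /=;
  by rewrite ?(rel_b2a1E, rel_b1a2E) zero_lfunE.
Defined.

Definition rfst (M N : rep k) : rhom (rsum M N) M.
Proof.
refine (@RHom k (rsum M N) M (fun v => lfst (M v) (N v)) _) => al.
by apply/lfunP=> x; rewrite !comp_lfunE lfstE lpairE comp_lfunE lfstE.
Defined.

Definition rsnd (M N : rep k) : rhom (rsum M N) N.
Proof.
refine (@RHom k (rsum M N) N (fun v => lsnd (M v) (N v)) _) => al.
by apply/lfunP=> x; rewrite !comp_lfunE lsndE lpairE !comp_lfunE lsndE.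
Defined.

Definition rpair (L M N : rep k) (f : rhom L M) (g : rhom L N) :
  rhom L (rsum M N).
Proof.
refine (@RHom k L (rsum M N) (fun v => lpair (f v) (g v)) _) => al.
by apply/lfunP=> x; rewrite !comp_lfunE !lpairE !comp_lfunE lfstE lsndE !rmapE.
Defined.

End RepCategory.

(* Differentials are indexed by proofs of [i + 1 = j], so that shifting does
   not require transporting along equalities of degrees. *)
Record cplx (k : fieldType) := Cplx {
  ob :> int -> rep k;
  diff : forall i j : int, i + 1 = j -> rhom (ob i) (ob j);
  diffK : forall (i j l : int) (e : i + 1 = j) (e' : j + 1 = l) (v : vertex),
    (diff e' v \o diff e v)%VF = 0;
  ob_bounded : exists N : nat, forall (i : int) (v : vertex) (x : ob i v),
    (N < `|i|)%N -> x = 0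
}.

Record cmap (k : fieldType) (X Y : cplx k) := CMap {
  cm :> forall i : int, rhom (X i) (Y i);
  cmP : forall (i j : int) (e : i + 1 = j) (v : vertex),
    (cm j v \o diff X e v)%VF = (diff Y e v \o cm i v)%VF
}.

Section Complexes.

Variable k : fieldType.

Lemma diffKE (X : cplx k) (i j l : int) (e : i + 1 = j) (e' : j + 1 = l) v x :
  diff X e' v (diff X e v x) = 0.
Proof. by rewrite -comp_lfunE diffK zero_lfunE. Qed.

Lemma cmE (X Y : cplx k) (f : cmap X Y) (i j : int) (e : i + 1 = j) v x :
  f j v (diff X e v x) = diff Y e v (f i v x).
Proof. by rewrite -!comp_lfunE cmP. Qed.

Definition cid (X : cplx k) : cmap X X.
Proof.
refine (@CMap k X X (fun i => rid (X i)) _) => i j e v.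
by rewrite /= comp_lfun1l comp_lfun1r.
Defined.

Definition ccomp (X Y Z : cplx k) (g : cmap Y Z) (f : cmap X Y) : cmap X Z.
Proof.
refine (@CMap k X Z (fun i => rcomp (g i) (f i)) _) => i j e v.
by apply/lfunP=> x; rewrite /= !comp_lfunE !cmE.
Defined.

Definition czero (X Y : cplx k) : cmap X Y.
Proof.
refine (@CMap k X Y (fun i => rzero (X i) (Y i)) _) => i j e v.
by rewrite /= comp_lfun0l comp_lfun0r.
Defined.

Definition homotopic (X Y : cplx k) (f g : cmap X Y) : Prop :=
  exists h : forall i j : int, i + 1 = j -> rhom (X j) (Y i),
  forall (i j l : int) (e : i + 1 = j) (e' : j + 1 = l) (v : vertex),
    f j v - g j v = (diff Y e v \o h i j e v)%VF + (h j l e' v \o diff X e' v)%VF.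

(* H^j(X) = 0 *)
Definition coh_vanish (X : cplx k) (j : int) : Prop :=
  forall (i l : int) (e : i + 1 = j) (e' : j + 1 = l) (v : vertex) (x : X j v),
    diff X e' v x = 0 -> exists y : X i v, x = diff X e v y.

(* injectivity and surjectivity of H^j(f) = Ker / Im at every vertex *)
Definition quasi_iso (X Y : cplx k) (f : cmap X Y) : Prop :=
  forall (i j l : int) (e : i + 1 = j) (e' : j + 1 = l) (v : vertex),
    (forall x : X j v, diff X e' v x = 0 ->
       (exists y : Y i v, f j v x = diff Y e v y) ->
       exists z : X i v, x = diff X e v z) /\
    (forall y : Y j v, diff Y e' v y = 0 ->
       exists (x : X j v) (z : Y i v),
         diff X e' v x = 0 /\ y = f j v x + diff Y e v z).

Lemma quasi_iso_id (X : cplx k) : quasi_iso (cid X).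
Proof.
move=> i j l e e' v; split=> [x _ [y]|y dy].
  by rewrite /= id_lfunE => ->; exists y.
by exists y, 0; rewrite /= id_lfunE linear0 addr0.
Qed.

Lemma shift_deg (m i j : int) : i + 1 = j -> (i + m) + 1 = j + m.
Proof. by move=> <-; rewrite addrAC. Qed.

(* X[m], with X[m]^i = X^(i+m) and d_{X[m]} = (-1)^m d_X *)
Definition shift (m : int) (X : cplx k) : cplx k.
Proof.
refine (@Cplx k (fun i => X (i + m))
  (fun i j e => rscale ((-1) ^+ `|m|%N) (diff X (shift_deg m e))) _ _).
- move=> i j l e e' v /=.
  by rewrite -comp_lfunZl -comp_lfunZr diffK !scaler0.
- have [N bN] := ob_bounded X; exists (N + `|m|)%N => i v x lt_i.
  apply: bN; rewrite -(ltn_add2r `|m|%N); apply: (leq_trans lt_i).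
  by rewrite -{1}(addrK m i) (leq_trans (leqD_dist _ 0 _)) // subr0 sub0r abszN.
Defined.

Definition shift_map (m : int) (X Y : cplx k) (f : cmap X Y) :
  cmap (shift m X) (shift m Y).
Proof.
refine (@CMap k (shift m X) (shift m Y) (fun i => f (i + m)) _) => i j e v /=.
by rewrite -comp_lfunZr -comp_lfunZl cmP.
Defined.

Lemma quasi_iso_shift (m : int) (X Y : cplx k) (f : cmap X Y) :
  quasi_iso f -> quasi_iso (shift_map m f).
Proof.
move=> qf i j l e e' v; set s : k := (-1) ^+ `|m|%N.
have ss (V : lmodType k) (x : V) : s *: (s *: x) = x.
  by rewrite scalerA -expr2 sqrr_sign scale1r.
have s0 (V : lmodType k) (x : V) : s *: x = 0 -> x = 0.
  by move=> sx; rewrite -[x]ss sx scaler0.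
have [inj_f sur_f] := qf _ _ _ (shift_deg m e) (shift_deg m e') v.
split=> [x /=|y /=]; rewrite !scale_lfunE -/s => /s0 dx.
  case=> y; rewrite scale_lfunE -/s -linearZ => fx.
  have [z ->] := inj_f x dx (ex_intro _ _ fx).
  by exists (s *: z); rewrite scale_lfunE -/s linearZ ss.
have [x [z [dx' ->]]] := sur_f y dx; exists x, (s *: z).
by rewrite !scale_lfunE -/s linearZ ss dx' scaler0.
Qed.

(* f^{i+1} seen as a map X^{i+1} -> Y^j, for j = i + 1 *)
Definition cone_off (X Y : cplx k) (f : cmap X Y) (i j : int) (e : i + 1 = j) :
  rhom (X (i + 1)) (Y j) :=
  match e in _ = j0 return rhom (X (i + 1)) (Y j0) with
  | erefl => f (i + 1)
  end.

(* Cone(f)^i = X^{i+1} (+) Y^i, with d (x, y) = (- d x, f x + d y) *)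
Definition cone (X Y : cplx k) (f : cmap X Y) : cplx k.
Proof.
refine (@Cplx k (fun i => rsum (shift 1 X i) (Y i))
  (fun i j e => rpair
     (rcomp (diff (shift 1 X) e) (rfst _ _))
     (radd (rcomp (cone_off f e) (rfst _ _)) (rcomp (diff Y e) (rsnd _ _))))
  _ _).
- move=> i j l e e' v; apply/lfunP=> x; case: l / e'; case: j / e => /=.
  rewrite comp_lfunE !lpairE !comp_lfunE !add_lfunE !comp_lfunE.
  rewrite !(lfstE, lsndE) /= !scale_lfunE !expr1 !scaleN1r zero_lfunE.
  rewrite !linearN /= diffKE !oppr0 linearD /= diffKE addr0.
  have -> : shift_deg 1 (erefl (i + 1)) = erefl (i + 1 + 1).
    exact: eq_irrelevance.
  by rewrite cmE addNr.
- have [N bN] := ob_bounded (shift 1 X); have [N' bN'] := ob_bounded Y.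
  exists (maxn N N') => i v [x y]; rewrite gtn_max => /andP[lt_i lt_i'].
  by rewrite (bN i v x lt_i) (bN' i v y lt_i').
Defined.

Definition cone_in (X Y : cplx k) (f : cmap X Y) : cmap Y (cone f).
Proof.
refine (@CMap k Y (cone f) (fun i => rpair (rzero _ _) (rid (Y i))) _).
move=> i j e v; apply/lfunP=> x /=.
rewrite !comp_lfunE !lpairE !(comp_lfunE, add_lfunE) !(lfstE, lsndE) /=.
by rewrite !zero_lfunE !id_lfunE !linear0 add0r.
Defined.

Definition cone_out (X Y : cplx k) (f : cmap X Y) : cmap (cone f) (shift 1 X).
Proof.
refine (@CMap k (cone f) (shift 1 X) (fun i => rfst _ _) _).
by move=> i j e v; apply/lfunP=> x; rewrite /= !comp_lfunE lfstE lpairE !comp_lfunE.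
Defined.

Definition stalk (M : rep k) : cplx k.
Proof.
refine (@Cplx k (fun i => if i == 0 then M else rep0 k)
  (fun i j e => rzero _ _) _ _).
- by move=> i j l e e' v; rewrite /= comp_lfun0l.
- exists 0%N => i v; case: eqP => [->|_] x //= _.
  by apply/rowP; case.
Defined.

End Complexes.

(* Objects are bounded complexes.  A morphism X -> Y is represented by a roof
   X <- Z -> Y whose left leg is a quasi-isomorphism, and [roof_eq] is the
   equality of the represented morphisms. *)
Record roof (k : fieldType) (X Y : cplx k) := Roof {
  apex : cplx k;
  den : cmap apex X;
  num : cmap apex Y;
  denP : quasi_iso den
}.
Arguments Roof {k X Y apex} den num denP.

Section Derived.

Variable k : fieldType.

Definition roof_eq (X Y : cplx k) (r r' : roof X Y) : Prop :=
  exists (W : cplx k) (u : cmap W (apex r)) (u' : cmap W (apex r')),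
    [/\ quasi_iso (ccomp (den r) u),
        homotopic (ccomp (den r) u) (ccomp (den r') u')
      & homotopic (ccomp (num r) u) (ccomp (num r') u')].

Definition roof_of (X Y : cplx k) (f : cmap X Y) : roof X Y :=
  Roof (cid X) f (@quasi_iso_id k X).

Definition roof_shift (m : int) (X Y : cplx k) (r : roof X Y) :
  roof (shift m X) (shift m Y) :=
  Roof (shift_map m (den r)) (shift_map m (num r)) (quasi_iso_shift m (denP r)).

(* [is_comp g f h] says that h = g o f in the derived category: up to
   homotopy, W completes f and g to the usual diagram of a composite of roofs,
   and dominates h. *)
Definition is_comp (X Y Z : cplx k) (g : roof Y Z) (f : roof X Y)
  (h : roof X Z) : Prop :=
  exists (W : cplx k) (u : cmap W (apex f)) (t : cmap W (apex g))
         (w : cmap W (apex h)),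
    [/\ quasi_iso (ccomp (den f) u),
        homotopic (ccomp (num f) u) (ccomp (den g) t),
        homotopic (ccomp (den f) u) (ccomp (den h) w)
      & homotopic (ccomp (num g) t) (ccomp (num h) w)].

Definition inverse_roofs (X Y : cplx k) (f : roof X Y) (g : roof Y X) : Prop :=
  is_comp g f (roof_of (cid X)) /\ is_comp f g (roof_of (cid Y)).

Definition is_iso (X Y : cplx k) (f : roof X Y) : Prop :=
  exists g : roof Y X, inverse_roofs f g.

Definition isomorphic (X Y : cplx k) : Prop := exists f : roof X Y, is_iso f.

(* g' o f = f' o g *)
Definition commutes (X Y X' Y' : cplx k) (f : roof X Y) (g' : roof Y Y')
  (g : roof X X') (f' : roof X' Y') : Prop :=
  exists h : roof X Y', is_comp g' f h /\ is_comp f' g h.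

Definition distinguished (X Y Z : cplx k)
  (f : roof X Y) (g : roof Y Z) (h : roof Z (shift 1 X)) : Prop :=
  exists (X' Y' : cplx k) (p : cmap X' Y')
    (x : roof X X') (y : roof Y Y') (z : roof Z (cone p)),
    [/\ is_iso x, is_iso y & is_iso z] /\
    [/\ commutes f y x (roof_of p),
        commutes g z y (roof_of (cone_in p))
      & commutes h (roof_shift 1 x) z (roof_of (cone_out p))].

Definition hom_zero (X Y : cplx k) : Prop :=
  forall f : roof X Y, roof_eq f (roof_of (czero X Y)).

Record tpair := TPair {
  tle : cplx k -> Prop;
  tge : cplx k -> Prop
}.

Definition iso_closed (P : cplx k -> Prop) : Prop :=
  forall X Y : cplx k, isomorphic X Y -> P X -> P Y.

(* t-structures on the full triangulated subcategory C; as the subcategories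
   are closed under isomorphisms, Y lies in D^{>=1} = D^{>=0}[-1] iff Y[1]
   lies in D^{>=0}, and Y lies in D^{>=0}[-a] iff Y[a] lies in D^{>=0}. *)
Definition is_tstructure (C : cplx k -> Prop) (t : tpair) : Prop :=
  [/\ (forall X, tle t X -> C X) /\ (forall X, tge t X -> C X),
      iso_closed (tle t) /\ iso_closed (tge t),
      (forall X, tle t X -> tle t (shift 1 X)) /\
      (forall X, tge t X -> tge t (shift (-1) X)),
      (forall X Y, tle t X -> C Y -> tge t (shift 1 Y) -> hom_zero X Y)
    & (forall X, C X -> exists (A B : cplx k)
         (f : roof A X) (g : roof X B) (h : roof B (shift 1 A)),
         [/\ tle t A, C B, tge t (shift 1 B) & distinguished f g h])].

Definition bounded_tstructure (C : cplx k -> Prop) (t : tpair) : Prop :=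
  forall X, C X -> exists a b : int, tge t (shift a X) /\ tle t (shift b X).

Definition conn_induced (t : tpair) (C : cplx k -> Prop) : tpair :=
  TPair (fun X => tle t X /\ C X)
        (fun X => C X /\
           forall X', tle t X' /\ C X' -> hom_zero (shift 1 X') X).

Definition connectively_induces (t : tpair) (C : cplx k -> Prop) : Prop :=
  is_tstructure C (conn_induced t C).

Definition std_tstructure : tpair :=
  TPair (fun X => forall i : int, 0 < i -> coh_vanish X i)
        (fun X => forall i : int, i < 0 -> coh_vanish X i).

(* The component C of a semiorthogonal decomposition <E, C>. *)
Definition left_orth (E : cplx k) (X : cplx k) : Prop :=
  forall n : int, hom_zero X (shift n E).

End Derived.

Definition E_plus (k : fieldType) : rep k.
Proof.
refine (@Rep k (fun v => k^o)
  (fun al => match al with a1 | b1 => \1%VF | a2 | b2 => 0 end) _ _).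
- exact: comp_lfun0l.
- exact: comp_lfun0r.
Defined.

Definition E_minus (k : fieldType) : rep k.
Proof.
refine (@Rep k (fun v => k^o)
  (fun al => match al with a1 | b1 => 0 | a2 | b2 => \1%VF end) _ _).
- exact: comp_lfun0r.
- exact: comp_lfun0l.
Defined.

Definition C_plus (k : fieldType) : cplx k -> Prop :=
  left_orth (stalk (E_plus k)).

Definition C_minus (k : fieldType) : cplx k -> Prop :=
  left_orth (stalk (E_minus k)).

Arguments C_plus k X : clear implicits.
Arguments C_minus k X : clear implicits.

(* Main.v *)
Require Import Defs.
From mathcomp Require Import all_boot all_order all_algebra.
From mathcomp Require Import zify.
From Stdlib Require Import ClassicalEpsilon.

Set Implicit Arguments.
Unset Strict Implicit.
Unset Printing Implicit Defensive.

Import Order.TTheory GRing.Theory Num.Theory.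
Local Open Scope ring_scope.

(** Fix a sign, and let [a] be the arrow from 1 to 2 that is the identity on E
    and [b] the arrow from 2 to 3 that vanishes on E; thus (a, b) = (a1, b2) for
    E_+ and (a2, b1) for E_-, and b a = 0 in both cases.  A map M -> E is the
    same thing as a linear form on M_3 that kills b M_2.  Deriving this, RHom(M, E)
    is the dual of the complex M_1 -a-> M_2 -b-> M_3, so a complex X lies in
    the component C iff the total complex

      Tot X = Tot (X_1 -a-> X_2 -b-> X_3)

    is acyclic ([left_orthP]).  To prove this inside the category of bounded
    complexes, X is replaced by a quasi-isomorphic complex [res X] such that
    res(X)_3 / b res(X)_2 is Tot X on the nose: chain maps from [res X] to a
    shift of E, and their homotopies, are then linear forms on Tot X.

    The truncation in C is obtained as follows.  Call a subrepresentation N of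
    H^n(X) divisible if b maps N_2 onto N_3.  There is a largest one, as sums of
    divisible subrepresentations are divisible.  Let A be the subcomplex of X
    that is X in degrees < n, the preimage of the largest divisible N in degree
    n, and 0 above.

    - If X is in C, so is A ([tot_acyclic_dtrunc]): what the exactness of Tot A
      requires from elements of X is supplied by the exactness of Tot X, and
      those elements generate divisible subrepresentations, hence lie in A.
    - If Y is in C and has no cohomology above degree n, exactness of Tot Y at
      its top says that H^n(Y) is divisible ([top_divisible]).  So Y has no
      nonzero map to a complex with neither cohomology below degree n nor a
      divisible part in degree n ([hom_zero_reduced]); such complexes are called
      reduced here.
    - The cone of A -> X, for n = 0, is reduced ([reduced_cone]), because A
      absorbs everything divisible; and it is in C.

    Hence A -> X -> cone is the truncation triangle, and the coaisle consists of
    the complexes of C that are reduced in degree -1 ([tgeP]).  Being reduced is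
    a condition on cohomology, so that invariance of the coaisle under
    isomorphisms and shifts needs no calculus of roofs; it holds trivially for
    complexes that vanish in degrees < 0, whence boundedness. *)

(** * Identities in abelian groups *)

(** The final 0 lets every summand occur as the left operand of an addition, so
    that one permutation rule brings any of them to the front. *)
Lemma abel_start (V : zmodType) (x y : V) : x + (- y + 0) = 0 -> x = y.
Proof. by rewrite addr0 => /eqP; rewrite subr_eq0 => /eqP. Qed.

Ltac abel_step V :=
  rewrite ?(@add0r V);
  lazymatch goal with
  | |- - ?x + _ = 0 =>
      do 40? rewrite [_ + (x + _)](@addrCA V); rewrite (@addNKr V)
  | |- ?x + _ = 0 =>
      do 40? rewrite [_ + (- x + _)](@addrCA V); rewrite (@addKr V)
  end.

(** Proves an identity of sums and differences by cancelling each summand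
    against its opposite.  The group is passed explicitly to the rewrite rules:
    the degrees occurring in the types are sums of integers, which must stay as
    they are. *)
Ltac abel :=
  apply: abel_start;
  lazymatch goal with
  | |- @eq _ (@Algebra.add (Algebra_Zmodule__to__Algebra_BaseAddMagma ?V) _ _) _ =>
    rewrite ?(@opprD V, @opprK V, @oppr0 V) -?(@addrA V);
    repeat abel_step V; rewrite ?(@add0r V) ?(@addr0 V); reflexivity
  end.

Section LinearMaps.
Variables (k : fieldType) (V W : vectType k) (f : 'Hom(V, W)).
Lemma lfunD x y : f (x + y) = f x + f y. Proof. exact: linearD. Qed.
Lemma lfunN x : f (- x) = - f x. Proof. exact: linearN. Qed.
Lemma lfun0 : f 0 = 0. Proof. exact: linear0. Qed.
Lemma lfunZ c x : f (c *: x) = c *: f x. Proof. exact: linearZ. Qed.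
End LinearMaps.

(** [linearN] would also apply to the opposite map itself and rewrite double
    opposites forever; these copies apply to homomorphisms of vector spaces
    only. *)
Definition lfunL := (lfunD, lfunN, lfun0).

(** * Cocycles, coboundaries and quasi-isomorphisms *)

Section Cohomology.
Variable k : fieldType.
Implicit Types X Y Z : cplx k.

Definition cyc X (j : int) v (x : X j v) : Prop :=
  forall l (e : j + 1 = l), diff X e v x = 0.

Definition bnd X (j : int) v (x : X j v) : Prop :=
  exists i (e : i + 1 = j) (y : X i v), x = diff X e v y.

Lemma cycP X j l (e : j + 1 = l) v (x : X j v) : diff X e v x = 0 -> cyc x.
Proof. by case: _ / e => dx l' e'; case: _ / e'. Qed.

Lemma bndP X i j (e : i + 1 = j) v (x : X j v) :
  bnd x -> exists y : X i v, x = diff X e v y.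
Proof.
case=> i' [e' [y ->]]; have Ei : i' = i by apply: (addIr 1); rewrite e e'.
by subst i'; exists y; rewrite (eq_irrelevance e e').
Qed.

Lemma bnd_diff X i j (e : i + 1 = j) v (y : X i v) : bnd (diff X e v y).
Proof. by exists i, e, y. Qed.

Lemma bnd_cyc X j v (x : X j v) : bnd x -> cyc x.
Proof. by case=> i [e [y ->]] l e'; rewrite diffKE. Qed.

Lemma cyc0 X j v : cyc (0 : X j v).
Proof. by move=> l e; rewrite linear0. Qed.

Lemma cycD X j v (x y : X j v) : cyc x -> cyc y -> cyc (x + y).
Proof. by move=> cx cy l e; rewrite linearD /= cx cy addr0. Qed.

Lemma cycZ X j v c (x : X j v) : cyc x -> cyc (c *: x).
Proof. by move=> cx l e; rewrite linearZ /= cx scaler0. Qed.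

Lemma cycN X j v (x : X j v) : cyc x -> cyc (- x).
Proof. by move=> cx l e; rewrite linearN /= cx oppr0. Qed.

Lemma cycB X j v (x y : X j v) : cyc x -> cyc y -> cyc (x - y).
Proof. by move=> cx cy; apply/cycD/cycN. Qed.

Lemma bnd0 X j v : bnd (0 : X j v).
Proof. by exists (j - 1), (subrK 1 j), 0; rewrite linear0. Qed.

Lemma bndD X j v (x y : X j v) : bnd x -> bnd y -> bnd (x + y).
Proof.
move=> [i [e [z ->]]] /(bndP e)[t ->]; exists i, e, (z + t).
by rewrite linearD.
Qed.

Lemma bndZ X j v c (x : X j v) : bnd x -> bnd (c *: x).
Proof. by move=> [i [e [z ->]]]; exists i, e, (c *: z); rewrite linearZ. Qed.

Lemma bndN X j v (x : X j v) : bnd x -> bnd (- x).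
Proof. by rewrite -scaleN1r; apply: bndZ. Qed.

Lemma bndB X j v (x y : X j v) : bnd x -> bnd y -> bnd (x - y).
Proof. by move=> bx bY; apply/bndD/bndN. Qed.

Lemma cyc_map X Y (f : cmap X Y) j v (x : X j v) : cyc x -> cyc (f j v x).
Proof. by move=> cx l e; rewrite -cmE cx linear0. Qed.

Lemma bnd_map X Y (f : cmap X Y) j v (x : X j v) : bnd x -> bnd (f j v x).
Proof. by move=> [i [e [y ->]]]; exists i, e, (f i v y); rewrite cmE. Qed.

Lemma cyc_act X j al (x : X j (src al)) : cyc x -> cyc (act (X j) al x).
Proof. by move=> cx l e; rewrite rmapE cx linear0. Qed.

Lemma bnd_act X j al (x : X j (src al)) : bnd x -> bnd (act (X j) al x).
Proof. by move=> [i [e [y ->]]]; exists i, e, (act (X i) al y); rewrite rmapE. Qed.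

Lemma coh_vanishP X j :
  coh_vanish X j <-> forall v (x : X j v), cyc x -> bnd x.
Proof.
split=> [H v x cx | H i l e e' v x dx].
  by have [y ->] := H _ _ (subrK 1 j) erefl v x (cx _ _); apply: bnd_diff.
by apply: bndP; apply: H; apply: (cycP dx).
Qed.

Definition coh_inj X Y (f : cmap X Y) : Prop :=
  forall j v (x : X j v), cyc x -> bnd (f j v x) -> bnd x.

Definition coh_surj X Y (f : cmap X Y) : Prop :=
  forall j v (y : Y j v), cyc y -> exists2 x, cyc x & bnd (y - f j v x).

Lemma quasi_isoP X Y (f : cmap X Y) :
  quasi_iso f <-> coh_inj f /\ coh_surj f.
Proof.
split=> [qf | [inj_f sur_f] i j l e e' v]; first split=> j v x cx.
- have [+ _] := qf _ _ _ (subrK 1 j) erefl v.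
  move=> /(_ x (cx _ _)) inj_f /(bndP (subrK 1 j)) [y fx].
  by have [|z ->] := inj_f; [exists y | apply: bnd_diff].
- have [_ +] := qf _ _ _ (subrK 1 j) erefl v.
  move=> /(_ x (cx _ _)) [y [z [dy ->]]]; exists y; first exact: cycP dy.
  by rewrite addrC addKr; apply: bnd_diff.
split=> [x /cycP cx [y fx] | y /cycP cy].
  by apply: bndP; apply: inj_f => //; rewrite fx; apply: bnd_diff.
have [x cx /(bndP e)[z yfx]] := sur_f _ _ _ cy.
by exists x, z; rewrite cx -yfx addrC subrK.
Qed.

Lemma homotopic_bnd X Y (f g : cmap X Y) j v (x : X j v) :
  homotopic f g -> cyc x -> bnd (f j v x - g j v x).
Proof.
move=> [h fg] cx.
have := congr1 (fun u : 'Hom(_, _) => u x)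
  (fg _ _ _ (subrK 1 j) (erefl (j + 1)) v).
rewrite /= add_lfunE opp_lfunE add_lfunE !comp_lfunE cx linear0 addr0 => ->.
exact: bnd_diff.
Qed.

Lemma homotopic_eq X Y (f g : cmap X Y) :
  (forall i v x, f i v x = g i v x) -> homotopic f g.
Proof.
move=> fg; exists (fun i j e => rzero _ _) => i j l e e' v.
apply/lfunP=> x; rewrite add_lfunE opp_lfunE fg subrr.
by rewrite add_lfunE !comp_lfunE !zero_lfunE linear0 addr0.
Qed.

Lemma coh_inj_homotopic X Y (f g : cmap X Y) :
  homotopic f g -> coh_inj f -> coh_inj g.
Proof.
move=> fg inj_f j v x cx bgx; apply: inj_f => //.
by rewrite -[f j v x](subrK (g j v x)); apply: bndD => //; apply: homotopic_bnd.
Qed.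

Lemma coh_surj_homotopic X Y (f g : cmap X Y) :
  homotopic f g -> coh_surj f -> coh_surj g.
Proof.
move=> fg sur_f j v y /sur_f [x cx byfx]; exists x => //.
rewrite -[y](subrK (f j v x)) -addrA; apply: bndD => //.
exact: homotopic_bnd.
Qed.

Lemma quasi_iso_homotopic X Y (f g : cmap X Y) :
  homotopic f g -> quasi_iso f -> quasi_iso g.
Proof.
move=> fg /quasi_isoP [i_f s_f]; apply/quasi_isoP; split.
  exact: coh_inj_homotopic i_f.
exact: coh_surj_homotopic s_f.
Qed.

Lemma homotopic_sym X Y (f g : cmap X Y) : homotopic f g -> homotopic g f.
Proof.
move=> [h fg].
exists (fun i j e => rscale (-1) (h i j e)) => i j l e e' v.
apply/lfunP=> x; have := congr1 (fun u : 'Hom(_, _) => u x) (fg _ _ _ e e' v).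
rewrite !(add_lfunE, opp_lfunE, comp_lfunE) /= !scale_lfunE !scaleN1r linearN /=.
by rewrite -opprD => <-; rewrite opprB.
Qed.

Lemma coh_inj_comp_l X Y Z (f : cmap X Y) (g : cmap Y Z) :
  coh_inj (ccomp g f) -> coh_inj f.
Proof.
move=> igf j v x cx bfx; apply: igf => //=; rewrite comp_lfunE.
exact: bnd_map.
Qed.

Lemma coh_surj_comp_r X Y Z (f : cmap X Y) (g : cmap Y Z) :
  coh_surj (ccomp g f) -> coh_surj g.
Proof.
move=> sgf j v y /sgf [x cx] /=; rewrite comp_lfunE => b.
by exists (f j v x) => //; apply: cyc_map.
Qed.

Lemma coh_inj_comp_r X Y Z (f : cmap X Y) (g : cmap Y Z) :
  coh_surj f -> coh_inj (ccomp g f) -> coh_inj g.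
Proof.
move=> sf igf j v y cy bgy; have [x cx byfx] := sf _ _ _ cy.
rewrite -[y](subrK (f j v x)); apply: bndD => //; apply: bnd_map.
apply: igf => //=; rewrite comp_lfunE.
rewrite -[f j v x](subKr y) linearB /=.
by apply: bndB => //; apply: bnd_map.
Qed.

Lemma coh_surj_comp_l X Y Z (f : cmap X Y) (g : cmap Y Z) :
  coh_inj g -> coh_surj (ccomp g f) -> coh_surj f.
Proof.
move=> ig sgf j v y cy; have [x cx] := sgf _ _ _ (cyc_map g cy).
rewrite /= comp_lfunE -linearB => b; exists x => //.
by apply: ig => //; apply: cycB => //; apply: cyc_map.
Qed.

Lemma quasi_iso_comp X Y Z (f : cmap X Y) (g : cmap Y Z) :
  quasi_iso f -> quasi_iso g -> quasi_iso (ccomp g f).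
Proof.
move=> /quasi_isoP[i_f s_f] /quasi_isoP[i_g s_g]; apply/quasi_isoP; split.
  move=> j v x cx /=; rewrite comp_lfunE => b; apply: i_f => //.
  by apply: i_g => //; apply: cyc_map.
move=> j v z /s_g [y cy b1]; have [x cx b2] := s_f _ _ _ cy; exists x => //.
rewrite /= comp_lfunE -[z](subrK (g j v y)) -addrA -linearB.
by apply: bndD => //; apply: bnd_map.
Qed.

Lemma quasi_iso_cancel_l X Y Z (f : cmap X Y) (g : cmap Y Z) :
  quasi_iso g -> quasi_iso (ccomp g f) -> quasi_iso f.
Proof.
move=> /quasi_isoP[i_g _] /quasi_isoP[i_gf s_gf]; apply/quasi_isoP.
by split; [apply: coh_inj_comp_l i_gf | apply: coh_surj_comp_l s_gf].
Qed.

Lemma coh_vanish_qis X Y (f : cmap X Y) j :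
  quasi_iso f -> coh_vanish X j <-> coh_vanish Y j.
Proof.
move=> /quasi_isoP[i_f s_f]; rewrite !coh_vanishP; split=> H v.
  move=> y /s_f [x /H bx b]; rewrite -[y](subrK (f j v x)).
  by apply: bndD => //; apply: bnd_map.
by move=> x cx; apply: i_f => //; apply/H/cyc_map.
Qed.

(** The second leg of the roofs compared in [roof_eq] can be forgotten, as the
    zero map absorbs it. *)
Lemma hom_zeroP X Y :
  hom_zero X Y <->
  forall Z (q : cmap Z X) (g : cmap Z Y), quasi_iso q ->
    exists W (u : cmap W Z), quasi_iso u /\ homotopic (ccomp g u) (czero W Y).
Proof.
split=> [H Z q g qis_q | H [Z q g qis_q]].
  have [W [u [u' [quis _ gu]]]] := H (Roof q g qis_q).
  exists W, u; split; first exact: quasi_iso_cancel_l quis.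
  case: gu => h gu; exists h => i j l e e' v; rewrite -gu.
  by congr (_ - _); rewrite /= comp_lfun0l.
have [W [u [qu [h gu]]]] := H Z q g qis_q.
exists W, u, (ccomp q u); split; first exact: quasi_iso_comp.
  by apply: homotopic_eq => i v x; rewrite /= !comp_lfunE id_lfunE.
exists h => i j l e e' v; rewrite -gu.
by congr (_ - _); rewrite /= comp_lfun0l.
Qed.

(** The two composites with an inverse roof make [num f] injective and surjective
    on cohomology. *)
Lemma is_iso_num_quasi_iso X Y (f : roof X Y) : is_iso f -> quasi_iso (num f).
Proof.
case=> g [[W [u [t [w [qfu fugt fuw gtw]]]]] [W' [u' [t' [w' [qgu gufT guw ftw]]]]]].
have qid (T V : cplx k) (p : cmap T V) : quasi_iso (ccomp (cid V) p) -> quasi_iso p.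
  by apply: quasi_iso_homotopic; apply: homotopic_eq => i v x; rewrite /= comp_lfunE id_lfunE.
have qw : quasi_iso w by apply: qid; apply: quasi_iso_homotopic fuw qfu.
have qw' : quasi_iso w' by apply: qid; apply: quasi_iso_homotopic guw qgu.
have toid (T V : cplx k) (p : cmap T V) : quasi_iso p -> quasi_iso (ccomp (cid V) p).
  by apply: quasi_iso_homotopic; apply: homotopic_eq => i v x; rewrite /= comp_lfunE id_lfunE.
have qft : quasi_iso (ccomp (num f) t').
  exact: quasi_iso_homotopic (homotopic_sym ftw) (toid _ _ _ qw').
have qgt : quasi_iso (ccomp (num g) t).
  exact: quasi_iso_homotopic (homotopic_sym gtw) (toid _ _ _ qw).
apply/quasi_isoP; split; last first.
  by apply: coh_surj_comp_r; apply: (proj2 (proj1 (quasi_isoP _) qft)).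
have /quasi_isoP[_ su] := quasi_iso_cancel_l (denP f) qfu.
apply: (coh_inj_comp_r su).
apply: (coh_inj_homotopic (homotopic_sym fugt)).
have /quasi_isoP[igt _] := qgt; have /coh_inj_comp_l it := igt.
have /quasi_isoP[idg _] := denP g.
move=> j v x cx /=; rewrite comp_lfunE => b; apply: it => //.
by apply: idg => //; apply: cyc_map.
Qed.

Lemma isomorphic_span X Y : isomorphic X Y ->
  exists Z (q : cmap Z X) (r : cmap Z Y), quasi_iso q /\ quasi_iso r.
Proof.
case=> f fiso; exists (apex f), (den f), (num f); split; first exact: denP.
exact: is_iso_num_quasi_iso.
Qed.

End Cohomology.

(** * Subspaces and subcomplexes *)

Section Subspaces.
Variables (k : fieldType).

(** Locked, since otherwise rewriting with [comp_lfunE] looks through it. *)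
Definition restr (V W : vectType k) (U : {vspace V}) (U' : {vspace W})
    (f : 'Hom(V, W)) : 'Hom(subvs_of U, subvs_of U') :=
  locked (linfun (@vsproj k W U') \o f \o linfun (@vsval k V U))%VF.

Lemma val_restr (V W : vectType k) (U : {vspace V}) (U' : {vspace W})
    (f : 'Hom(V, W)) x :
  (forall y, y \in U -> f y \in U') -> vsval (restr U U' f x) = f (vsval x).
Proof.
by move=> fU; rewrite /restr -lock !comp_lfunE !lfunE /= vsprojK //; apply/fU/subvsP.
Qed.

(** A subspace of largest dimension inside [P] must be all of [P]. *)
Lemma subspace_of_predicate (V : vectType k) (P : V -> Prop) :
  P 0 -> (forall c x y, P x -> P y -> P (c *: x + y)) ->
  exists U : {vspace V}, forall x, x \in U <-> P x.
Proof.
move=> P0 Plin.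
suff grow n (U : {vspace V}) : (forall x, x \in U -> P x) ->
    (\dim {:V} - \dim U <= n)%N -> exists U : {vspace V}, forall x, x \in U <-> P x.
  by apply: (grow _ 0%VS _ (leqnn _)) => x; rewrite memv0 => /eqP->.
elim: n U => [|n IHn] U UP.
  rewrite leqn0 subn_eq0 => dU.
  have UT : U = fullv by apply/eqP; rewrite eqEdim subvf.
  by exists U => x; split=> [/UP // | _]; rewrite UT memvf.
move=> dU; case: (classic (exists2 x, P x & x \notin U)) => [[x Px xU] | noP].
  apply: (IHn (U + <[x]>)%VS).
    move=> _ /memv_addP[u uU [_ /vlineP[c ->] ->]].
    by rewrite addrC; apply: Plin => //; apply: UP.
  have lt_dim : (\dim U < \dim (U + <[x]>))%N.
    have UUx : (U <= U + <[x]>)%VS := addvSl _ _.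
    rewrite ltn_neqAle dimvS // andbT; apply: contra xU => /eqP dimE.
    have -> : U = (U + <[x]>)%VS by apply/eqP; rewrite eqEdim UUx dimE leqnn.
    by apply: (subvP (addvSr _ _)); apply: memv_line.
  by rewrite -ltnS; apply: leq_trans dU; apply: ltn_sub2l => //;
     apply: leq_trans lt_dim (dimvS (subvf _)).
exists U => x; split=> [/UP // | Px]; case: (boolP (x \in U)) => // xU.
by case: noP; exists x.
Qed.

Definition vspace_of (V : vectType k) (P : V -> Prop) : {vspace V} :=
  epsilon (inhabits 0%VS) (fun U : {vspace V} => forall x, x \in U <-> P x).

Lemma mem_vspace_of (V : vectType k) (P : V -> Prop) x :
  P 0 -> (forall c x y, P x -> P y -> P (c *: x + y)) ->
  x \in vspace_of P <-> P x.
Proof.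
move=> P0 Plin.
by apply: (epsilon_spec (inhabits 0%VS)
   (fun U : {vspace V} => forall x, x \in U <-> P x)); apply: subspace_of_predicate.
Qed.

End Subspaces.

Section Subcomplex.
Variables (k : fieldType) (X : cplx k).

Record subfamily := SubFamily {
  subsp :> forall i v, {vspace X i v};
  subsp_act : forall i al x, x \in subsp i (src al) ->
    act (X i) al x \in subsp i (tgt al);
  subsp_diff : forall i j (e : i + 1 = j) v x, x \in subsp i v ->
    diff X e v x \in subsp j v
}.

Variable U : subfamily.

Definition subrep (i : int) : rep k.
Proof.
refine (@Rep k (fun v => subvs_of (U i v))
  (fun al => restr (U i (src al)) (U i (tgt al)) (act (X i) al)) _ _);
  apply/lfunP=> x; apply: subvs_inj; rewrite comp_lfunE zero_lfunE /=.
- by rewrite !val_restr ?rel_b2a1E // => y; apply: (@subsp_act U i b2) || apply: (@subsp_act U i a1).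
- by rewrite !val_restr ?rel_b1a2E // => y; apply: (@subsp_act U i b1) || apply: (@subsp_act U i a2).
Defined.

Lemma val_subrep_act i al (x : subrep i (src al)) :
  vsval (act (subrep i) al x) = act (X i) al (vsval x).
Proof. by apply: val_restr => y; apply: subsp_act. Qed.

Definition subdiff i j (e : i + 1 = j) : rhom (subrep i) (subrep j).
Proof.
refine (@RHom k (subrep i) (subrep j)
  (fun v => restr (U i v) (U j v) (diff X e v)) _) => al.
apply/lfunP=> x; apply: subvs_inj; rewrite !comp_lfunE.
have dU v y : y \in U i v -> diff X e v y \in U j v by apply: subsp_diff.
rewrite (val_restr _ (dU _)) (val_restr _ (@subsp_act U j al)).
by rewrite (val_restr _ (dU _)) (val_restr _ (@subsp_act U i al)) rmapE.
Defined.

Lemma val_subdiff i j (e : i + 1 = j) v (x : subrep i v) :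
  vsval (subdiff e v x) = diff X e v (vsval x).
Proof. by apply: val_restr => y; apply: subsp_diff. Qed.

Definition subcplx : cplx k.
Proof.
refine (@Cplx k subrep subdiff _ _).
- move=> i j l e e' v; apply/lfunP=> x; apply: subvs_inj.
  by rewrite comp_lfunE !val_subdiff diffKE zero_lfunE.
- have [N bN] := ob_bounded X; exists N => i v x ltNi.
  by apply: subvs_inj; apply: bN.
Defined.

Definition subrep_incl (i : int) : rhom (subrep i) (X i).
Proof.
refine (@RHom k (subrep i) (X i) (fun v => linfun (@vsval k (X i v) (U i v))) _).
by move=> al; apply/lfunP=> x; rewrite !comp_lfunE !lfunE; apply: val_subrep_act.
Defined.

Definition incl : cmap subcplx X.
Proof.
refine (@CMap k subcplx X subrep_incl _) => i j e v; apply/lfunP=> x.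
by rewrite !comp_lfunE !lfunE; apply: val_subdiff.
Defined.

Lemma inclE i v (x : subcplx i v) : incl i v x = vsval x.
Proof. exact: lfunE. Qed.

Lemma incl_inj i v (x y : subcplx i v) : incl i v x = incl i v y -> x = y.
Proof. by rewrite !inclE; apply: subvs_inj. Qed.

Lemma incl_mem i v (x : subcplx i v) : incl i v x \in U i v.
Proof. by rewrite inclE; apply: subvsP. Qed.

Lemma incl_sur i v x : x \in U i v -> exists y, incl i v y = x.
Proof. by move=> xU; exists (Subvs xU); rewrite inclE. Qed.

Lemma incl_cyc i v (x : subcplx i v) : cyc (incl i v x) -> cyc x.
Proof. by move=> cx l e; apply: incl_inj; rewrite cmE cx linear0. Qed.

Section Factor.
Variables (Z : cplx k) (g : cmap Z X).
Hypothesis gU : forall i v x, g i v x \in U i v.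

Definition factor_space i v : 'Hom(Z i v, subcplx i v) :=
  locked (linfun (@vsproj k (X i v) (U i v)) \o g i v)%VF.

Lemma val_factor_space i v x : vsval (factor_space i v x) = g i v x.
Proof. by rewrite /factor_space -lock comp_lfunE lfunE /= vsprojK ?gU. Qed.

Definition factor_rep i : rhom (Z i) (subcplx i).
Proof.
refine (@RHom k (Z i) (subcplx i) (factor_space i) _) => al.
apply/lfunP=> x; apply: subvs_inj.
by rewrite comp_lfunE [LHS]val_factor_space comp_lfunE [RHS]val_subrep_act
   val_factor_space rmapE.
Defined.

Definition factor : cmap Z subcplx.
Proof.
refine (@CMap k Z subcplx factor_rep _) => i j e v; apply/lfunP=> x.
apply: subvs_inj; rewrite comp_lfunE [LHS]val_factor_space.
by rewrite comp_lfunE [RHS]val_subdiff [vsval _]val_factor_space cmE.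
Defined.

Lemma incl_factor i v x : incl i v (factor i v x) = g i v x.
Proof. by rewrite inclE; apply: val_factor_space. Qed.

End Factor.
End Subcomplex.

(** * Truncations *)

Section Truncation.
Variables (k : fieldType) (X : cplx k) (n : int).

(** A subrepresentation of the cohomology in degree [n], given by its preimage
    among the cocycles.  A family over all degrees, so that no subspace has to be
    transported along an equality of degrees. *)
Record layer := Layer {
  laysp :> forall i v, {vspace X i v};
  layer_cyc : forall v x, x \in laysp n v -> cyc x;
  layer_bnd : forall v x, bnd x -> x \in laysp n v;
  layer_act : forall al x, x \in laysp n (src al) ->
    act (X n) al x \in laysp n (tgt al)
}.

Variable K : layer.

Definition truncsp (i : int) v : {vspace X i v} :=
  if i < n then fullv else if i == n then K i v else 0%VS.

Lemma truncsp_lt i v (x : X i v) : i < n -> x \in truncsp i v.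
Proof. by rewrite /truncsp => ->; rewrite memvf. Qed.

Lemma truncsp_n v (x : X n v) : (x \in truncsp n v) = (x \in K n v).
Proof. by rewrite /truncsp ltxx eqxx. Qed.

Lemma truncsp_gt i v (x : X i v) : n < i -> x \in truncsp i v -> x = 0.
Proof.
move=> lt_ni; rewrite /truncsp ltNge (ltW lt_ni) /= (gt_eqF lt_ni).
by rewrite memv0 => /eqP.
Qed.

Lemma truncsp_act i al x : x \in truncsp i (src al) ->
  act (X i) al x \in truncsp i (tgt al).
Proof.
case: (ltgtP i n) => [lt_in | gt_in | ?]; first by rewrite !truncsp_lt.
  by move/(truncsp_gt gt_in)=> ->; rewrite linear0 mem0v.
by subst i; rewrite !truncsp_n; apply: layer_act.
Qed.

Lemma truncsp_diff i j (e : i + 1 = j) v x : x \in truncsp i v ->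
  diff X e v x \in truncsp j v.
Proof.
case: (ltgtP i n) => [lt_in _ | gt_in | ?].
- case: (ltgtP j n) => [lt_jn | gt_jn | ?]; [exact: truncsp_lt | lia | move: e; subst j => e].
  by rewrite truncsp_n; apply: layer_bnd; apply: bnd_diff.
- by move/(truncsp_gt gt_in)=> ->; rewrite linear0 mem0v.
- by subst i; rewrite truncsp_n => /layer_cyc->; rewrite mem0v.
Qed.

Definition trunc_family := SubFamily truncsp_act truncsp_diff.
Definition trunc := subcplx trunc_family.
Definition trunc_in : cmap trunc X := incl trunc_family.

Lemma trunc_lt i v (x : X i v) : i < n -> exists y, trunc_in i v y = x.
Proof. by move=> lt_in; apply/incl_sur/truncsp_lt. Qed.

Lemma trunc_n v (x : X n v) : x \in K n v -> exists y, trunc_in n v y = x.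
Proof. by move=> xK; apply: incl_sur; rewrite /= truncsp_n. Qed.

Lemma trunc_n_mem v (x : trunc n v) : trunc_in n v x \in K n v.
Proof. by rewrite -truncsp_n; apply: (incl_mem (U := trunc_family)). Qed.

Lemma trunc_gt i v (x : trunc i v) : n < i -> x = 0.
Proof.
move=> lt_ni; apply: incl_inj; rewrite linear0.
exact: (truncsp_gt lt_ni (incl_mem (U := trunc_family) x)).
Qed.

Lemma trunc_inj i v (x y : trunc i v) :
  trunc_in i v x = trunc_in i v y -> x = y.
Proof. exact: incl_inj. Qed.

Lemma trunc_bnd i v (x : trunc i v) : i <= n -> bnd (trunc_in i v x) -> bnd x.
Proof.
move=> le_in [h [e [y xE]]].
have [|z zy] := @trunc_lt _ _ y; first by lia.
by exists h, e, z; apply: trunc_inj; rewrite cmE zy.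
Qed.

Lemma trunc_coh_vanish j : n < j -> coh_vanish trunc j.
Proof.
by move=> lt_nj; apply/coh_vanishP => v x _; rewrite (trunc_gt x lt_nj); apply: bnd0.
Qed.
End Truncation.

Section CanonicalTruncation.
Variables (k : fieldType) (X : cplx k) (n : int).

Definition cycsp (i : int) v : {vspace X i v} := lker (diff X (erefl (i + 1)) v).

Lemma mem_cycsp i v (x : X i v) : x \in cycsp i v <-> cyc x.
Proof. by rewrite memv_ker; split=> [/eqP/cycP | ->]. Qed.

Definition cyc_layer : layer X n.
Proof.
exists cycsp => [v x /mem_cycsp // | v x /bnd_cyc/mem_cycsp // | al x].
by move/mem_cycsp/cyc_act/mem_cycsp.
Defined.

Definition ctrunc : cplx k := trunc cyc_layer.

Definition ctrunc_in : cmap ctrunc X := trunc_in cyc_layer.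

Lemma ctrunc_in_cyc v (x : ctrunc n v) : cyc (ctrunc_in n v x).
Proof. by apply/mem_cycsp; apply: trunc_n_mem. Qed.

Lemma ctrunc_gt i v (x : ctrunc i v) : n < i -> x = 0.
Proof. exact: trunc_gt. Qed.

Lemma ctrunc_quasi_iso :
  (forall j, n < j -> coh_vanish X j) -> quasi_iso ctrunc_in.
Proof.
move=> X0; apply/quasi_isoP; split=> j v x cx.
  case: (lerP j n) => [le_jn | lt_nj _]; first exact: trunc_bnd.
  by rewrite (ctrunc_gt x lt_nj); apply: bnd0.
case: (ltgtP j n) => [lt_jn | gt_jn | ?].
- have [y yx] := trunc_lt cyc_layer x lt_jn; exists y.
    by apply: incl_cyc; rewrite [incl _ _ _ _]yx.
  by rewrite [ctrunc_in _ _ _]yx subrr; apply: bnd0.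
- exists 0; first exact: cyc0.
  by rewrite linear0 subr0; apply: (proj1 (coh_vanishP _ _)) => //; apply: X0.
- subst j; have [y yx] := trunc_n (K := cyc_layer) (proj2 (mem_cycsp x) cx).
  exists y; first by apply: incl_cyc; rewrite [incl _ _ _ _]yx.
  by rewrite [ctrunc_in _ _ _]yx subrr; apply: bnd0.
Qed.
End CanonicalTruncation.

(** * The arrows and the complex Tot *)

Section Arrows.
Variable k : fieldType.

(** [fa s] and [fb s] are the two arrows whose composite is zero; [true] stands
    for E_+ and [false] for E_-. *)
Definition fa (s : bool) (M : rep k) : 'Hom(M v1, M v2) :=
  if s then act M a1 else act M a2.
Definition fb (s : bool) (M : rep k) : 'Hom(M v2, M v3) :=
  if s then act M b2 else act M b1.

Lemma fbfa s (M : rep k) x : fb s M (fa s M x) = 0.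
Proof. by case: s; rewrite ?rel_b2a1E ?rel_b1a2E. Qed.

Lemma rmap_fa s (M N : rep k) (f : rhom M N) x :
  f v2 (fa s M x) = fa s N (f v1 x).
Proof. by case: s; [apply: (rmapE f (al := a1)) | apply: (rmapE f (al := a2))]. Qed.

Lemma rmap_fb s (M N : rep k) (f : rhom M N) x :
  f v3 (fb s M x) = fb s N (f v2 x).
Proof. by case: s; [apply: (rmapE f (al := b2)) | apply: (rmapE f (al := b1))]. Qed.

Lemma act_stable (s : bool) (M : rep k) (P : forall v, M v -> Prop) :
  (forall x, P v1 x -> P v2 (fa s M x)) ->
  (forall x, P v1 x -> P v2 (fa (~~ s) M x)) ->
  (forall x, P v2 x -> P v3 (fb s M x)) ->
  (forall x, P v2 x -> P v3 (fb (~~ s) M x)) ->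
  forall al x, P (src al) x -> P (tgt al) (act M al x).
Proof. by case: s => /= ? ? ? ? []. Qed.

Lemma cyc_fa s (X : cplx k) j (x : X j v1) : cyc x -> cyc (fa s (X j) x).
Proof. by move=> cx l e; rewrite rmap_fa cx linear0. Qed.
Lemma cyc_fb s (X : cplx k) j (x : X j v2) : cyc x -> cyc (fb s (X j) x).
Proof. by move=> cx l e; rewrite rmap_fb cx linear0. Qed.
Lemma bnd_fb s (X : cplx k) j (x : X j v2) : bnd x -> bnd (fb s (X j) x).
Proof. by case=> i [e [y ->]]; rewrite -rmap_fb; apply: bnd_diff. Qed.

End Arrows.

Section Tot.
Variables (k : fieldType) (s : bool).
Implicit Types X Y Z : cplx k.
Local Notation a := (fa s _).
Local Notation b := (fb s _).

(** The differential of Tot sends (y1, y2, y3) to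
    (d y1, a y1 - d y2, d y3 - b y2). *)
Definition tot_cocycle X i j l (e : i + 1 = j) (e' : j + 1 = l)
    (x1 : X l v1) (x2 : X j v2) (x3 : X i v3) : Prop :=
  [/\ cyc x1, diff X e' v2 x2 = a x1 & diff X e v3 x3 = b x2].

(** The last component of the primitive is hidden in [bnd]. *)
Definition tot_acyclic X : Prop := forall i j l (e : i + 1 = j) (e' : j + 1 = l)
    (x1 : X l v1) (x2 : X j v2) (x3 : X i v3), tot_cocycle e e' x1 x2 x3 ->
  exists (y1 : X j v1) (y2 : X i v2),
    [/\ x1 = diff X e' v1 y1, x2 = a y1 - diff X e v2 y2 & bnd (x3 + b y2)].

(** A quasi-isomorphism is surjective on the cohomology of Tot: the cocycle is
    lifted one vertex after the other, correcting at each step by the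
    coboundaries chosen before. *)
Lemma tot_cocycle_lift X Y (f : cmap X Y) i j l (e : i + 1 = j) (e' : j + 1 = l)
    (x1 : Y l v1) (x2 : Y j v2) (x3 : Y i v3) :
  quasi_iso f -> tot_cocycle e e' x1 x2 x3 ->
  exists (w1 : X l v1) (w2 : X j v2) (w3 : X i v3) (y1 : Y j v1) (y2 : Y i v2),
    tot_cocycle e e' w1 w2 w3 /\
    [/\ x1 = f l v1 w1 + diff Y e' v1 y1,
        x2 = f j v2 w2 + (a y1 - diff Y e v2 y2)
      & bnd (x3 - f i v3 w3 + b y2)].
Proof.
move=> /quasi_isoP[i_f s_f] [c1 d2 d3].
have [w1 cw1 /(bndP e')[y1 E1]] := s_f _ _ _ c1.
have x1E : x1 = f l v1 w1 + diff Y e' v1 y1 by rewrite -E1 addrC subrK.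
have [w2' aw1] : exists w2', a w1 = diff X e' v2 w2'.
  apply: bndP; apply: i_f; first exact: cyc_fa.
  rewrite rmap_fa; have -> : f l v1 w1 = x1 - diff Y e' v1 y1 by rewrite x1E addrK.
  rewrite !lfunL -d2 -rmap_fa -linearB; exact: bnd_diff.
have c2 : cyc (x2 - a y1 - f j v2 w2').
  apply: (@cycP _ _ _ _ e'); rewrite !lfunL d2 rmap_fa -cmE -aw1 rmap_fa -linearB.
  by rewrite x1E addrK subrr.
have [w2'' cw2 /(bndP e)[y2 E2]] := s_f _ _ _ c2.
pose w2 := w2' + w2''.
have dw2 : diff X e' v2 w2 = a w1 by rewrite !lfunL cw2 addr0.
have x2E : x2 = f j v2 w2 + (a y1 - diff Y e v2 (- y2)).
  by rewrite !lfunL -E2; abel.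
have [w3' bw2] : exists w3', b w2 = diff X e v3 w3'.
  apply: bndP; apply: i_f.
    by apply: (@cycP _ _ _ _ e'); rewrite rmap_fb dw2 fbfa.
  rewrite rmap_fb; have -> : f j v2 w2 = x2 - (a y1 - diff Y e v2 (- y2)).
    by rewrite x2E addrK.
  have -> : b (x2 - (a y1 - diff Y e v2 (- y2))) = diff Y e v3 (x3 - b y2).
    by rewrite !lfunL fbfa d3 rmap_fb; abel.
  exact: bnd_diff.
have c3 : cyc (x3 - f i v3 w3' + b (- y2)).
  apply: (@cycP _ _ _ _ e); rewrite !lfunL d3 -cmE -bw2 !rmap_fb.
  by rewrite {1}x2E !lfunL fbfa; abel.
have [w3'' cw3 b3] := s_f _ _ _ c3.
exists w1, w2, (w3' + w3''), y1, (- y2); split; first split=> //.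
  by rewrite lfunD cw3 addr0.
split=> //; have -> // : x3 - f i v3 (w3' + w3'') + b (- y2) =
  x3 - f i v3 w3' + b (- y2) - f i v3 w3''.
by rewrite !lfunL; abel.
Qed.

Lemma tot_acyclic_qis_cod X Y (f : cmap X Y) :
  quasi_iso f -> tot_acyclic X -> tot_acyclic Y.
Proof.
move=> qf aX i j l e e' x1 x2 x3 /(tot_cocycle_lift qf).
move=> [w1 [w2 [w3 [y1 [y2 [/aX [z1 [z2 [-> -> bw]]] [-> -> bx]]]]]]].
exists (f j v1 z1 + y1), (f i v2 z2 + y2); split.
- by rewrite !lfunL cmE.
- by rewrite !lfunL rmap_fa cmE; abel.
- have -> : x3 + b (f i v2 z2 + y2) = (x3 - f i v3 w3 + b y2) + f i v3 (w3 + b z2).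
    by rewrite !lfunL rmap_fb; abel.
  by apply: bndD => //; apply: bnd_map.
Qed.

Lemma tot_acyclic_qis_dom X Y (f : cmap X Y) :
  quasi_iso f -> tot_acyclic Y -> tot_acyclic X.
Proof.
move=> /quasi_isoP[i_f s_f] aY i j l e e' w1 w2 w3 [c1 d2 d3].
have [] := aY i j l e e' (f l v1 w1) (f j v2 w2) (f i v3 w3).
  by split; [exact: cyc_map | rewrite -cmE d2 rmap_fa | rewrite -cmE d3 rmap_fb].
move=> y1 [y2 [E1 E2 B3]].
have [z1' W1] : exists z1', w1 = diff X e' v1 z1'.
  by apply/bndP/i_f => //; rewrite E1; apply: bnd_diff.
have [|z1'' cz1 /(bndP e)[t1 T1]] := s_f _ _ (y1 - f j v1 z1').
  by apply: (@cycP _ _ _ _ e'); rewrite !lfunL -cmE -W1 E1 subrr.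
pose z1 := z1' + z1''.
have fz1 : f j v1 z1 = y1 - diff Y e v1 t1 by rewrite !lfunL -T1; abel.
have Z1 : w1 = diff X e' v1 z1 by rewrite !lfunL cz1 addr0.
clearbody z1.
have [z2' W2] : exists z2', a z1 - w2 = diff X e v2 z2'.
  apply/bndP/i_f.
    by apply: (@cycP _ _ _ _ e'); rewrite !lfunL d2 rmap_fa -Z1 subrr.
  rewrite !lfunL rmap_fa fz1 E2.
  have -> : a (y1 - diff Y e v1 t1) - (a y1 - diff Y e v2 y2) = diff Y e v2 (y2 - a t1).
    by rewrite !lfunL rmap_fa; abel.
  exact: bnd_diff.
have [|z2'' cz2 b2] := s_f _ _ (y2 - a t1 - f i v2 z2').
  apply: (@cycP _ _ _ _ e); rewrite !lfunL -cmE -W2 !lfunL !rmap_fa fz1 E2.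
  by rewrite !lfunL; abel.
exists z1, (z2' + z2''); split=> //.
  by rewrite !lfunL cz2 addr0 -W2; abel.
apply: i_f.
  apply: (@cycP _ _ _ _ e).
  by rewrite !lfunL d3 !rmap_fb cz2 -W2 !lfunL fbfa; abel.
have -> : f i v3 (w3 + b (z2' + z2'')) =
  (f i v3 w3 + b y2) - b (y2 - a t1 - f i v2 z2' - f i v2 z2'').
  by rewrite !lfunL !rmap_fb fbfa; abel.
by apply: bndB => //; apply: bnd_fb.
Qed.

Lemma tot_acyclic_shift m X : tot_acyclic X -> tot_acyclic (shift m X).
Proof.
move=> aX i j l e e' x1 x2 x3 [c1 d2 d3].
set c : k := (-1) ^+ `|m|%N.
have cc (V : lmodType k) (x : V) : c *: (c *: x) = x.
  by rewrite scalerA -expr2 sqrr_sign scale1r.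
have c0 (V : lmodType k) (x y : V) : c *: x = y -> x = c *: y by move=> <-; rewrite cc.
have dE h h' (eh : h + 1 = h') v (x : shift m X h v) :
  diff (shift m X) eh v x = c *: diff X (shift_deg m eh) v x by rewrite /= scale_lfunE.
rewrite !dE in d2 d3; move/c0: d2 => d2; move/c0: d3 => d3.
have [|y1 [y2 [E1 E2 [h [eh [y3 E3]]]]]] :=
  aX _ _ _ (shift_deg m e) (shift_deg m e') x1 (c *: x2) x3.
  split.
  - apply: (@cycP _ _ _ _ (shift_deg m (erefl (l + 1)))).
    by have := c1 _ erefl; rewrite dE => /c0; rewrite scaler0.
  - by rewrite linearZ /= d2 cc.
  - by rewrite d3 linearZ.
exists (c *: y1), (c *: (c *: y2)); split.
- by rewrite dE linearZ /= cc.
- by rewrite dE cc lfunZ -scalerBr -E2 cc.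
- rewrite cc E3.
  have Eh : h = (h - m) + m by rewrite subrK.
  move: y3 eh E3; rewrite Eh => y3 eh E3.
  have eh' : h - m + 1 = i by apply: (addIr m); rewrite -eh addrAC.
  exists (h - m), eh', (c *: y3); rewrite dE linearZ /= cc.
  by congr (diff X _ _ _); apply: eq_irrelevance.
Qed.

End Tot.

(** * Tot of a cone *)

Section Cone.
Variables (k : fieldType) (s : bool) (X Y : cplx k) (f : cmap X Y).

Definition in_cone i v (x : X (i + 1) v) (y : Y i v) : cone f i v := (x, y).

Lemma cone_diffE i v (x : X (i + 1) v) (y : Y i v) :
  diff (cone f) (erefl (i + 1)) v (in_cone x y) =
  in_cone (- diff X (erefl (i + 1 + 1)) v x)
          (f (i + 1) v x + diff Y (erefl (i + 1)) v y).
Proof.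
rewrite /= lpairE !(comp_lfunE, add_lfunE) !(lfstE, lsndE) /=.
rewrite scale_lfunE /= expr1 scaleN1r.
by rewrite (eq_irrelevance (shift_deg 1 (erefl (i + 1))) erefl).
Qed.

Lemma cone_faE i (x : X (i + 1) v1) (y : Y i v1) :
  fa s (cone f i) (in_cone x y) = in_cone (fa s _ x) (fa s _ y).
Proof.
rewrite /in_cone; case: s; rewrite /= lpairE !comp_lfunE !(lfstE, lsndE) //=.
Qed.

Lemma cone_fbE i (x : X (i + 1) v2) (y : Y i v2) :
  fb s (cone f i) (in_cone x y) = in_cone (fb s _ x) (fb s _ y).
Proof.
rewrite /in_cone; case: s; rewrite /= lpairE !comp_lfunE !(lfstE, lsndE) //=.
Qed.

Lemma in_cone_inj i v (x x' : X (i + 1) v) (y y' : Y i v) :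
  in_cone x y = in_cone x' y' -> x = x' /\ y = y'.
Proof. by case. Qed.

Lemma in_coneD i v (x x' : X (i + 1) v) (y y' : Y i v) :
  in_cone x y + in_cone x' y' = in_cone (x + x') (y + y').
Proof. by []. Qed.

Lemma in_coneN i v (x : X (i + 1) v) (y : Y i v) :
  - in_cone x y = in_cone (- x) (- y).
Proof. by []. Qed.

Lemma in_cone_cyc i v (x : X (i + 1) v) (y : Y i v) :
  cyc (in_cone x y) ->
  cyc x /\ diff Y (erefl (i + 1)) v y = - f (i + 1) v x.
Proof.
move=> /(_ _ erefl); rewrite cone_diffE => /(in_cone_inj (x' := 0) (y' := 0)).
case=> /eqP; rewrite oppr_eq0 => /eqP dx /eqP; rewrite addr_eq0 => /eqP dy.
by split; [apply: cycP dx | rewrite dy opprK].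
Qed.

Lemma bnd_cone i v (z : cone f i v) :
  bnd z -> exists x : X i v, bnd (z.2 - f i v x).
Proof.
case=> h [e [[x y] ->]]; case: _ / e; exists x.
rewrite -/(in_cone x y) cone_diffE /=.
have -> : f (h + 1) v x + diff Y erefl v y - f (h + 1) v x = diff Y erefl v y.
  by abel.
exact: bnd_diff.
Qed.

(** A primitive of the component in X[1], whose middle entry changes sign, is
    pushed to Y by [f]; what remains is a cocycle of Tot Y. *)
Lemma tot_acyclic_cone : tot_acyclic s X -> tot_acyclic s Y -> tot_acyclic s (cone f).
Proof.
move=> aX aY i j l; have [p ->] : exists p, i = p + 1 by exists (i - 1); rewrite subrK.
move=> e e'; case: _ / e'; case: _ / e.
move=> [/= x1 y1] [/= x2 y2] [/= x3 y3] [].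
rewrite -!/(in_cone _ _) !cone_diffE cone_faE cone_fbE.
move=> /in_cone_cyc [c1 d1] /in_cone_inj [dx2 dy2] /in_cone_inj [dx3 dy3].
have [|z1 [z2 [E1 E2 /(bndP erefl)[z3 E3]]]] := aX _ _ _ erefl erefl x1 (- x2) x3.
  split=> //; first by rewrite lfunN.
  by rewrite -[LHS]opprK dx3 lfunN.
pose y1' := y1 + f _ _ z1; pose y2' := y2 + f _ _ z2; pose y3' := y3 + f _ _ z3.
have x2E : x2 = diff X erefl v2 z2 - fa s _ z1 by rewrite -[x2]opprK E2; abel.
have [|u1 [u2 [F1 F2 /(bndP erefl)[u3 F3]]]] := aY _ _ _ erefl erefl y1' y2' y3'.
  split.
  - apply: (cycP (e := erefl)).
    by rewrite /y1' lfunD d1 -cmE -E1; abel.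
  - have dy2' : diff Y erefl v2 y2 = fa s _ y1 - f _ _ x2 by rewrite -dy2; abel.
    by rewrite /y2' /y1' !lfunD dy2' x2E !lfunL cmE rmap_fa; abel.
  - have dy3' : diff Y erefl v3 y3 = fb s _ y2 - f _ _ x3 by rewrite -dy3; abel.
    have x3E : x3 = diff X erefl v3 z3 - fb s _ z2 by rewrite -E3; abel.
    by rewrite /y3' /y2' !lfunD dy3' x3E !lfunL cmE rmap_fb; abel.
exists (in_cone (- z1) u1), (in_cone z2 u2).
rewrite !cone_diffE cone_faE cone_fbE; split.
- by rewrite lfunN opprK -E1 lfunN -F1 /y1'; congr in_cone; abel.
- rewrite in_coneN in_coneD; congr in_cone; first by rewrite x2E lfunN; abel.
  have -> : y2 = y2' - f _ _ z2 by rewrite /y2'; abel.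
  by rewrite F2; abel.
- exists p, erefl, (in_cone (- z3) u3); rewrite cone_diffE in_coneD.
  rewrite lfunN opprK -E3 lfunN -F3; congr in_cone.
  by rewrite /y3'; abel.
Qed.

End Cone.

(** * Divisible parts and reduced complexes *)

Section Divisible.
Variables (k : fieldType) (s : bool).
Implicit Types X Y Z : cplx k.
Local Notation a := (fa s _).
Local Notation b := (fb s _).

(** Modulo coboundaries, the linear span of [N] is a subrepresentation of H^n(X)
    on which b is onto.  Linearity is not imposed on [N]: the union [dpart] of
    all such families is linear anyway. *)
Definition divisible X n (N : forall v, X n v -> Prop) : Prop :=
  [/\ forall v x, N v x -> cyc x,
      forall al x, N (src al) x -> N (tgt al) (act (X n) al x)
    & forall x, N v3 x -> exists2 y, N v2 y & bnd (x - b y)].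

Definition dpart X n v (x : X n v) : Prop :=
  exists2 N : forall v, X n v -> Prop, divisible N & N v x.

Lemma dpart_divisible X n : divisible (@dpart X n).
Proof.
split=> [v x [N [cN _ _] /cN] // | al x [N dN Nx] | x [N dN Nx]].
  by exists N => //; case: dN => _ aN _; apply: aN.
by case: (dN) => _ _ /(_ x Nx) [y Ny bxy]; exists y => //; exists N.
Qed.

Lemma dpart_cyc X n v (x : X n v) : dpart x -> cyc x.
Proof. by case: (dpart_divisible X n) => + _ _; apply. Qed.

Lemma dpart_fa t X n (x : X n v1) : dpart x -> dpart (fa t (X n) x).
Proof.
case: (dpart_divisible X n) => _ aN _.
by case: t; [apply: (aN a1) | apply: (aN a2)].
Qed.

Lemma dpart_fb t X n (x : X n v2) : dpart x -> dpart (fb t (X n) x).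
Proof.
case: (dpart_divisible X n) => _ aN _.
by case: t; [apply: (aN b2) | apply: (aN b1)].
Qed.

Lemma bnd_dpart X n v (x : X n v) : bnd x -> dpart x.
Proof.
move=> bx; exists (fun v (x : X n v) => bnd x) => //; split=> [u y /bnd_cyc // | al y | y bY].
  exact: bnd_act.
by exists 0; [apply: bnd0 | rewrite lfun0 subr0].
Qed.

Lemma dpart_lin X n v c (x y : X n v) : dpart x -> dpart y -> dpart (c *: x + y).
Proof.
move=> dx dy; case: (dpart_divisible X n) => cN aN bN.
exists (fun v z => exists p q : X n v, [/\ dpart p, dpart q & z = c *: p + q]).
  split=> [u _ [p [q [/cN cp /cN cq ->]]] | al _ [p [q [dp dq ->]]] | _ [p [q [dp dq ->]]]].
  - exact: cycD (cycZ c cp) cq.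
  - exists (act (X n) al p), (act (X n) al q).
    by split; [apply: aN | apply: aN | rewrite lfunD lfunZ].
  - have [[p' dp' bp] [q' dq' bq]] := (bN _ dp, bN _ dq).
    exists (c *: p' + q'); first by exists p', q'.
    have -> : c *: p + q - b (c *: p' + q') = c *: (p - b p') + (q - b q').
      by rewrite lfunD lfunZ scalerBr; abel.
    by apply: bndD => //; apply: bndZ.
by exists x, y.
Qed.

(** The cohomological description of the objects without nonzero maps from the
    objects of C in degrees <= n. *)
Definition reduced n X : Prop :=
  (forall j, j < n -> coh_vanish X j) /\
  (forall v (x : X n v), dpart x -> bnd x).

Lemma reduced_qis_dom n X Y (f : cmap X Y) :
  quasi_iso f -> reduced n Y -> reduced n X.
Proof.
move=> qf [Y0 Yd]; split=> [j /Y0 | v x [N [cN aN bN] Nx]].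
  by rewrite -(coh_vanish_qis j qf).
have /quasi_isoP[i_f _] := qf; apply: i_f; first exact: (cN _ _ Nx).
apply: Yd; exists (fun v y => exists2 x, N v x & y = f n v x); last by exists x.
split=> [u _ [z Nz ->] | al _ [z Nz ->] | _ [z Nz ->]].
- by apply/cyc_map/(cN _ _ Nz).
- by exists (act (X n) al z); [apply: aN | rewrite rmapE].
- have [y Ny by'] := bN _ Nz; exists (f n v2 y); first by exists y.
  by rewrite -rmap_fb -linearB; apply: bnd_map.
Qed.

Lemma reduced_qis_cod n X Y (f : cmap X Y) :
  quasi_iso f -> reduced n X -> reduced n Y.
Proof.
move=> qf [X0 Xd]; split=> [j /X0 | v y [N [cN aN bN] Ny]].
  by rewrite (coh_vanish_qis j qf).
have /quasi_isoP[i_f s_f] := qf.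
have [x cx bx] := s_f _ _ _ (cN _ _ Ny).
rewrite -[y](subrK (f n v x)); apply: bndD => //; apply: bnd_map; apply: Xd.
exists (fun v x => cyc x /\ exists2 y, N v y & bnd (y - f n v x)).
  split=> [u z [] // | al z [cz [w Nw bw]] | z [cz [w Nw bw]]].
    split; first exact: cyc_act.
    exists (act (Y n) al w); first exact: aN.
    by rewrite rmapE -linearB; apply: bnd_act.
  have [w' Nw' bw'] := bN _ Nw; have [z' cz' bz'] := s_f _ _ _ (cN _ _ Nw').
  exists z'; first by split=> //; exists w'.
  apply: i_f; first by apply: cycB => //; apply: cyc_fb.
  have -> : f n v3 (z - b z') = (w - b w') - (w - f n v3 z) + b (w' - f n v2 z').
    by rewrite !lfunL rmap_fb; abel.
  by apply: bndD; [apply: bndB | apply: bnd_fb].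
by split=> //; exists y.
Qed.

(** A cocycle x of degree n at the vertex 3 is a cocycle (0, 0, x) of Tot, hence
    x = - b y2 up to a coboundary, with d y2 = a y1 and y1 a cocycle of degree
    n + 1.  As y1 = d y0, the element a y0 - y2 is a cocycle that b maps to x. *)
Lemma top_divisible X n : tot_acyclic s X -> coh_vanish X (n + 1) ->
  divisible (fun v (x : X n v) => cyc x).
Proof.
move=> aX /coh_vanishP X0; split=> [// | al x | x cx]; first exact: cyc_act.
have [|y1 [y2 [E1 E2 E3]]] := aX n _ _ erefl erefl 0 0 x.
  by split; [apply: cyc0 | rewrite !lfun0 | rewrite cx lfun0].
have [y0 Y0] : exists y0, y1 = diff X erefl v1 y0.
  by apply/bndP/X0; apply: (cycP (e := erefl)); rewrite -E1.
exists (a y0 - y2).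
  apply: (cycP (e := erefl)).
  by rewrite !lfunL rmap_fa -Y0 -[LHS]/(a y1 - diff X erefl v2 y2) -E2.
by rewrite !lfunL fbfa; have -> : x - (0 - b y2) = x + b y2 by abel.
Qed.

Lemma mem_vspace_of_dpart X n v (x : X n v) : x \in vspace_of (@dpart X n v) <-> dpart x.
Proof.
apply: mem_vspace_of; first by apply/bnd_dpart/bnd0.
by move=> c y z; apply: dpart_lin.
Qed.

Definition dlayer X n : layer X n.
Proof.
exists (fun i v => vspace_of (@dpart X i v)) => [v x | v x | al x].
- by move/mem_vspace_of_dpart/dpart_cyc.
- by move/bnd_dpart/mem_vspace_of_dpart.
- move/mem_vspace_of_dpart=> dx; apply/mem_vspace_of_dpart.
  by case: (dpart_divisible X n) => _ aN _; apply: aN.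
Defined.

Lemma mem_dlayer X n v (x : X n v) : x \in dlayer X n n v <-> dpart x.
Proof. exact: mem_vspace_of_dpart. Qed.

Definition dtrunc X n : cplx k := trunc (dlayer X n).
Definition dtrunc_in X n : cmap (dtrunc X n) X := trunc_in (dlayer X n).

(** By degree j of the middle entry: below n, nothing distinguishes A from X; for
    j = n + 1 the claim is the divisibility of the layer; for j = n a primitive
    y1 of degree n is a cocycle with a y1 in A, and adding it and its images
    under the other arrows to [dpart] keeps this divisible, so y1 is in A. *)
Lemma tot_acyclic_dtrunc X n : tot_acyclic s X -> tot_acyclic s (dtrunc X n).
Proof.
set A := dtrunc X n; pose u : cmap A X := dtrunc_in X n.
move=> aX i j l e e' x1 x2 x3 [c1 d2 d3].
case: (ltgtP j n) => [lt_jn | gt_jn | jn].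
- have [|y1 [y2 [E1 E2 E3]]] := aX _ _ _ e e' (u l v1 x1) (u j v2 x2) (u i v3 x3).
    by split; [apply: cyc_map | rewrite -cmE d2 rmap_fa | rewrite -cmE d3 rmap_fb].
  have [z1 Z1] := trunc_lt (dlayer X n) y1 lt_jn.
  have [|z2 Z2] := trunc_lt (dlayer X n) y2; first by lia.
  exists z1, z2; split.
  + by apply: (@trunc_inj _ _ _ (dlayer X n)); rewrite cmE Z1 -E1.
  + by apply: (@trunc_inj _ _ _ (dlayer X n)); rewrite !lfunL cmE rmap_fa Z1 Z2 -E2.
  + apply: (@trunc_bnd _ _ _ (dlayer X n)); first by lia.
    by rewrite lfunD rmap_fb Z2.
- have x10 : x1 = 0 by apply: (@trunc_gt _ _ _ (dlayer X n)); lia.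
  have x20 : x2 = 0 by apply: (@trunc_gt _ _ _ (dlayer X n)); lia.
  case: (ltgtP i n) => [| gt_in | ni]; [lia | |].
    have x30 : x3 = 0 by apply: (@trunc_gt _ _ _ (dlayer X n)).
    by exists 0, 0; rewrite x10 x20 x30 !lfunL subr0 addr0; split=> //; apply: bnd0.
  subst i; have := trunc_n_mem x3 => /mem_dlayer.
  case: (dpart_divisible X n) => _ _ bN /bN [y /mem_dlayer].
  case/(trunc_n (K := dlayer X n)) => z <- bz.
  exists 0, (- z); split.
  + by rewrite lfun0.
  + rewrite !lfunL opprK add0r x20; apply/esym.
    by apply: (@trunc_gt _ _ _ (dlayer X n)); lia.
  + by apply: (@trunc_bnd _ _ _ (dlayer X n)) => //; rewrite !lfunL rmap_fb.
- move: e e' x1 x2 x3 c1 d2 d3; rewrite jn => e e' x1 x2 x3 c1 d2 d3.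
  have x10 : x1 = 0 by apply: (@trunc_gt _ _ _ (dlayer X n)); lia.
  have [|y1 [y2 [E1 E2 E3]]] := aX _ _ _ e e' 0 (u n v2 x2) (u i v3 x3).
    split; first exact: cyc0.
      by rewrite -cmE d2 x10 !lfunL.
    by rewrite -cmE d3 rmap_fb.
  have cy1 : cyc y1 by apply: (cycP (e := e')); rewrite -E1.
  have [|z2 Z2] := trunc_lt (dlayer X n) y2; first by lia.
  have day1 : dpart (a y1).
    have -> : a y1 = 1 *: u n v2 x2 + diff X e v2 y2 by rewrite scale1r E2; abel.
    apply: dpart_lin; last by apply/bnd_dpart/bnd_diff.
    by apply/mem_dlayer/trunc_n_mem.
  have dy1 : dpart y1.
    (* b of the other image of y1 accounts for the new part of N_3; the other
       composites are zero or already in [dpart] *)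
    pose N v (x : X n v) : Prop :=
      match v return X n v -> Prop with
      | v1 => fun x => exists c d, [/\ dpart d & x = c *: y1 + d]
      | v2 => fun x => exists c d, [/\ dpart d & x = c *: fa (~~ s) (X n) y1 + d]
      | v3 => fun x => exists c d, [/\ dpart d & x = c *: b (fa (~~ s) (X n) y1) + d]
      end x.
    exists N; last by exists 1, 0; rewrite scale1r addr0; split=> //; apply/bnd_dpart/bnd0.
    have [cD aD bD] := dpart_divisible X n.
    have d0 v : dpart (0 : X n v) by apply/bnd_dpart/bnd0.
    split.
    - case=> x [c [d [/cD cd ->]]]; apply: cycD => //; apply: cycZ => //.
        exact: cyc_fa.
      by apply/cyc_fb/cyc_fa.
    - apply: (@act_stable k s (X n) N) => _ [c [d [dd ->]]]; rewrite lfunD lfunZ.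
      + exists 0, (c *: a y1 + a d); rewrite scale0r add0r; split=> //.
        by apply: dpart_lin => //; apply: dpart_fa.
      + by exists c, (fa (~~ s) (X n) d); split=> //; apply: dpart_fa.
      + by exists c, (b d); split=> //; apply: dpart_fb.
      + exists 0, (fb (~~ s) (X n) d); rewrite fbfa scaler0 scale0r; split=> //.
        exact: dpart_fb.
    - move=> _ [c [d [dd ->]]]; have [y dy bdy] := bD _ dd.
      exists (c *: fa (~~ s) (X n) y1 + y); first by exists c, y.
      by rewrite lfunD lfunZ opprD addrACA subrr add0r.
  have [z1 Z1] := trunc_n (K := dlayer X n) (proj2 (mem_dlayer _) dy1).
  exists z1, z2; split.
  + by apply: (@trunc_inj _ _ _ (dlayer X n)); rewrite cmE Z1 x10 lfun0 -E1.
  + by apply: (@trunc_inj _ _ _ (dlayer X n)); rewrite !lfunL cmE rmap_fa Z1 Z2 -E2.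
  + apply: (@trunc_bnd _ _ _ (dlayer X n)); first by lia.
    by rewrite lfunD rmap_fb Z2.
Qed.
End Divisible.

(** * Maps to acyclic complexes *)

Section DegreeCast.
Variable k : fieldType.
Implicit Types X Y : cplx k.

Definition dcast X i j (p : i = j) : rhom (X i) (X j) :=
  match p with erefl => rid (X i) end.

Lemma diff_dcast X i j l (p : i = j) (e : j + 1 = l) (e' : i + 1 = l) v x :
  diff X e v (dcast X p v x) = diff X e' v x.
Proof. by case: _ / p e => e; rewrite id_lfunE (eq_irrelevance e e'). Qed.

Lemma dcast_diff X i j l (p : j = l) (e : i + 1 = j) (e' : i + 1 = l) v x :
  dcast X p v (diff X e v x) = diff X e' v x.
Proof. by case: _ / p e' => e'; rewrite id_lfunE (eq_irrelevance e e'). Qed.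

Lemma dcastK X i j (p : i = j) (q : j = i) v x :
  dcast X q v (dcast X p v x) = x.
Proof. by case: _ / p q => q; rewrite (eq_irrelevance q erefl) !id_lfunE. Qed.

End DegreeCast.

Section Cocone.
Variables (k : fieldType) (X N : cplx k) (f : cmap X N).

Lemma cocone_deg (i j : int) : i + 1 = j -> i = j - 1.
Proof. by move=> <-; rewrite addrK. Qed.

Definition cocone_diff i j (e : i + 1 = j) :
    rhom (rsum (X i) (N (i - 1))) (rsum (X j) (N (j - 1))) :=
  rpair (rcomp (diff X e) (rfst _ _))
    (radd (rcomp (dcast N (cocone_deg e)) (rcomp (f i) (rfst _ _)))
          (rscale (-1) (rcomp (diff N (shift_deg (-1) e)) (rsnd _ _)))).

Lemma cocone_diffE i j (e : i + 1 = j) v x y :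
  cocone_diff e v (x, y) =
  (diff X e v x, dcast N (cocone_deg e) v (f i v x) - diff N (shift_deg (-1) e) v y).
Proof.
rewrite /= lpairE !(comp_lfunE, add_lfunE, scale_lfunE) !(lfstE, lsndE) /=.
by rewrite scaleN1r.
Qed.

Definition cocone : cplx k.
Proof.
refine (@Cplx k (fun i => rsum (X i) (N (i - 1))) cocone_diff _ _).
- move=> i j l e e' v; apply/lfunP=> -[x y].
  rewrite comp_lfunE !cocone_diffE zero_lfunE diffKE lfunD lfunN diffKE.
  have eil : i + 1 = l - 1 by apply: (addIr 1); rewrite subrK e e'.
  by rewrite cmE (diff_dcast _ _ eil) (dcast_diff _ _ eil); congr pair; abel.
- have [B bB] := ob_bounded X; have [B' bB'] := ob_bounded N.
  exists (maxn B B'.+1) => i v [x y]; rewrite gtn_max => /andP[lt_i lt_i'].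
  by rewrite (bB i v x lt_i) (bB' _ v y) //; lia.
Defined.

Definition cocone_out : cmap cocone X.
Proof.
refine (@CMap k cocone X (fun i => rfst _ _) _) => i j e v.
by apply/lfunP=> -[x y]; rewrite !comp_lfunE [diff cocone _ _ _]cocone_diffE /= !lfstE.
Defined.

Lemma cocone_out_null : homotopic (ccomp f cocone_out) (czero cocone N).
Proof.
have p (i j : int) (e : i + 1 = j) : j - 1 = i by rewrite -e addrK.
exists (fun i j e => rcomp (dcast N (p i j e)) (rsnd (X j) (N (j - 1)))).
move=> i j l e e' v; apply/lfunP=> -[x y].
rewrite add_lfunE opp_lfunE add_lfunE zero_lfunE !comp_lfunE.
rewrite [diff cocone _ _ _]cocone_diffE /= !(comp_lfunE, lfstE, lsndE) /=.
have ey : j - 1 + 1 = j by rewrite subrK.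
by rewrite lfunD lfunN dcastK (diff_dcast _ _ ey) (dcast_diff _ _ ey); abel.
Qed.

Lemma cocone_out_quasi_iso : (forall j, coh_vanish N j) -> quasi_iso cocone_out.
Proof.
move=> N0; apply/quasi_isoP; split=> j v.
- move=> [x y] cxy; rewrite /= lfstE /= => -[i [e [z xE]]].
  move: (cxy _ erefl); rewrite [diff cocone _ _ _]cocone_diffE => -[dx dy].
  have [t Et] : exists t : N (i - 1) v,
      dcast N (cocone_deg e) v (f i v z) - y = diff N (shift_deg (-1) e) v t.
    apply/bndP; apply: (proj1 (coh_vanishP _ _) (N0 _)).
    apply: (cycP (e := shift_deg (-1) (erefl (j + 1)))).
    have ej : i + 1 = j + 1 - 1 by rewrite addrK.
    rewrite lfunD lfunN (diff_dcast _ _ ej).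
    by rewrite xE cmE (dcast_diff _ _ ej) in dy.
  exists i, e, (z, t); rewrite [diff cocone _ _ _]cocone_diffE xE; congr pair.
  by rewrite -Et; abel.
- move=> x cx.
  have [t Et] : exists t : N (j - 1) v, f j v x = diff N (subrK 1 j) v t.
    by apply/bndP; apply: (proj1 (coh_vanishP _ _) (N0 _)); apply: cyc_map.
  exists (x, t); last by rewrite /= lfstE subrr; apply: bnd0.
  apply: (cycP (e := erefl)); rewrite [diff cocone _ _ _]cocone_diffE cx Et.
  have ej : j - 1 + 1 = j + 1 - 1 by rewrite addrAC.
  by rewrite (dcast_diff _ _ ej) (eq_irrelevance ej (shift_deg (-1) (erefl (j + 1)))) subrr.
Qed.

Lemma map_to_acyclic_null : (forall j, coh_vanish N j) ->
  exists W (u : cmap W X), quasi_iso u /\ homotopic (ccomp f u) (czero W N).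
Proof.
by move=> N0; exists cocone, cocone_out; split; [apply: cocone_out_quasi_iso | apply: cocone_out_null].
Qed.

End Cocone.

(** * Maps to reduced complexes *)

Section Orthogonality.
Variables (k : fieldType) (s : bool).
Implicit Types X Y Z : cplx k.

Lemma homotopic_comp_zero X Y Z (f : cmap X Y) (r : cmap Y Z) (g : cmap X Z) :
  (forall i v x, g i v x = r i v (f i v x)) ->
  homotopic f (czero X Y) -> homotopic g (czero X Z).
Proof.
move=> gE [h fh]; exists (fun i j e => rcomp (r i) (h i j e)) => i j l e e' v.
apply/lfunP=> x; have := congr1 (fun u : 'Hom(_, _) => r j v (u x)) (fh _ _ _ e e' v).
rewrite !(add_lfunE, opp_lfunE, comp_lfunE, zero_lfunE) /= gE.
by rewrite !subr0 lfunD cmE.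
Qed.

Lemma dtrunc_acyclic n Y : reduced s n Y -> forall j, coh_vanish (dtrunc s Y n) j.
Proof.
move=> [Y0 Yd] j; case: (ltgtP j n) => [lt_jn | lt_nj | ->].
- apply/coh_vanishP => v x cx; apply: (@trunc_bnd _ _ _ (dlayer s Y n)); first exact: ltW.
  by apply: (proj1 (coh_vanishP _ _) (Y0 _ lt_jn)); apply: cyc_map.
- exact: trunc_coh_vanish.
- apply/coh_vanishP => v x cx; apply: (@trunc_bnd _ _ _ (dlayer s Y n)) => //.
  by apply/Yd/mem_dlayer/trunc_n_mem.
Qed.

(** After truncation of the apex, the numerator lands in the subcomplex
    [dtrunc s Y n] of the target, because the image of a divisible family is
    divisible; and that subcomplex is acyclic as [Y] is reduced. *)
Lemma hom_zero_reduced n X Y : tot_acyclic s X -> (forall j, n < j -> coh_vanish X j) ->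
  reduced s n Y -> hom_zero X Y.
Proof.
move=> aX X0 rY; apply/hom_zeroP => Z q g qq.
have aZ := tot_acyclic_qis_dom qq aX.
have Z0 j : n < j -> coh_vanish Z j by move=> /X0; rewrite (coh_vanish_qis j qq).
pose u := ctrunc_in Z n.
have guU i v x : ccomp g u i v x \in trunc_family (dlayer s Y n) i v.
  rewrite /= comp_lfunE; case: (ltgtP i n) => [lt_in | lt_ni | i_n].
  - exact: truncsp_lt.
  - by rewrite (ctrunc_gt x lt_ni) !lfun0 mem0v.
  - move: x; rewrite i_n => x; rewrite truncsp_n; apply/mem_dlayer.
    have dZ : divisible s (fun v (x : Z n v) => cyc x).
      by apply: top_divisible => //; apply: Z0; lia.
    exists (fun v y => exists2 z : Z n v, cyc z & y = g n v z); last first.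
      by exists (u n v x) => //; apply: ctrunc_in_cyc.
    case: dZ => _ aN bN; split=> [w _ [z cz ->] | al _ [z cz ->] | _ [z cz ->]].
    + exact: cyc_map.
    + by exists (act (Z n) al z); [apply: aN | rewrite rmapE].
    + have [y cy bz] := bN _ cz; exists (g n v2 y); first by exists y.
      by rewrite -rmap_fb -linearB; apply: bnd_map.
have [W [w [qw hw]]] := map_to_acyclic_null (factor guU) (dtrunc_acyclic rY).
exists W, (ccomp u w); split.
  by apply: quasi_iso_comp => //; apply: ctrunc_quasi_iso.
apply: (homotopic_comp_zero (r := incl (trunc_family (dlayer s Y n))) _ hw) => i v x.
have -> : ccomp (factor guU) w i v x = factor guU i v (w i v x) by exact: comp_lfunE.
rewrite (incl_factor guU).
by rewrite /= !comp_lfunE.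
Qed.

Lemma unshift_deg (i : int) : i + 1 - 1 = i.
Proof. exact: addrK. Qed.

Definition unshift X : cmap (shift 1 (shift (-1) X)) X.
Proof.
refine (@CMap k (shift 1 (shift (-1) X)) X (fun i => dcast X (unshift_deg i)) _).
move=> i j e v; apply/lfunP=> x; rewrite !comp_lfunE /= !scale_lfunE /=.
rewrite scalerA mulrNN mulr1 scale1r.
have e1 : i + 1 - 1 + 1 = j by rewrite addrK.
by rewrite (dcast_diff _ _ e1) (diff_dcast _ _ e1).
Defined.

Lemma unshift_lift X j v (x : X j v) : cyc x ->
  exists2 x' : shift 1 (shift (-1) X) j v, cyc x' & unshift X j v x' = x.
Proof.
move=> cx; exists (dcast X (esym (unshift_deg j)) v x); last exact: dcastK.
move=> l e; rewrite /= !scale_lfunE /=.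
have e1 : j + 1 = l + 1 - 1 by rewrite addrK.
by rewrite (diff_dcast _ _ e1) cx !scaler0.
Qed.

(** The inclusion of A = [dtrunc s Y (-1)], which is in C, vanishes in the derived
    category, so every cocycle of A is a coboundary of [Y]. *)
Lemma reduced_of_hom_zero Y : tot_acyclic s Y ->
  (forall X, (forall j, 0 < j -> coh_vanish X j) -> tot_acyclic s X ->
     hom_zero (shift 1 X) Y) ->
  reduced s (-1) Y.
Proof.
move=> aY H; set A := dtrunc s Y (-1); pose u : cmap A Y := dtrunc_in s Y (-1).
have A0 j : 0 < j -> coh_vanish (shift (-1) A) j.
  move=> lt0j; apply/coh_vanishP => v x _.
  have -> : x = 0 by apply: (@trunc_gt _ _ _ (dlayer s Y (-1))); lia.
  exact: bnd0.
have /hom_zeroP H0 := H _ A0 (tot_acyclic_shift (tot_acyclic_dtrunc aY)).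
have [W [w [qw hw]]] := H0 _ (cid _) (ccomp u (unshift A)) (@quasi_iso_id _ _).
have key j v (x : A j v) : cyc x -> bnd (u j v x).
  move=> cx; have /quasi_isoP[_ sw] := qw.
  have [x' cx' <-] := unshift_lift cx.
  have [z cz /(bnd_map (unshift A)) /(bnd_map u)] := sw _ _ _ cx'.
  rewrite !lfunD !lfunN => bx.
  have := homotopic_bnd hw cz; rewrite zero_lfunE subr0 /= !comp_lfunE => bz.
  by rewrite -[u j v (unshift A j v x')](subrK (u j v (unshift A j v (w j v z)))); apply: bndD.
split=> [j lt_j | v y dy].
  apply/coh_vanishP => v y cy.
  have [x Ex] := trunc_lt (dlayer s Y (-1)) y lt_j.
  rewrite -Ex; apply: key; apply: incl_cyc; rewrite [incl _ _ _ _]Ex //.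
have [x Ex] := trunc_n (K := dlayer s Y (-1)) (proj2 (mem_dlayer _ _) dy).
rewrite -Ex; apply: key; apply: incl_cyc; rewrite [incl _ _ _ _]Ex.
exact: dpart_cyc dy.
Qed.
End Orthogonality.

(** * The t-structure on the complexes with acyclic Tot *)

Section Roofs.
Variable k : fieldType.
Implicit Types X Y Z : cplx k.

Lemma is_comp_id_den X Y Z (g : roof Y Z) (f : roof X Y) (h : roof X Z)
    (u : cmap X (apex f)) (t : cmap X (apex g)) (w : cmap X (apex h)) :
  (forall i v x, den f i v (u i v x) = x) ->
  (forall i v x, num f i v (u i v x) = den g i v (t i v x)) ->
  (forall i v x, den h i v (w i v x) = x) ->
  (forall i v x, num g i v (t i v x) = num h i v (w i v x)) ->
  is_comp g f h.
Proof.
move=> fu fg hw gh; exists X, u, t, w; split.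
- apply: quasi_iso_homotopic (quasi_iso_id X); apply: homotopic_eq => i v x.
  by rewrite /= id_lfunE comp_lfunE fu.
- by apply: homotopic_eq => i v x; rewrite /= !comp_lfunE fg.
- by apply: homotopic_eq => i v x; rewrite /= !comp_lfunE fu hw.
- by apply: homotopic_eq => i v x; rewrite /= !comp_lfunE gh.
Qed.

Ltac solve_is_comp u t w :=
  unshelve eapply is_comp_id_den; [exact u | exact t | exact w | ..];
  move=> i v x; rewrite /= ?id_lfunE.

Lemma is_iso_id X : is_iso (roof_of (cid X)).
Proof.
by exists (roof_of (cid X)); split;
  solve_is_comp (cid X) (cid X) (cid X).
Qed.

Lemma cone_distinguished X Y (f : cmap X Y) :
  distinguished (roof_of f) (roof_of (cone_in f)) (roof_of (cone_out f)).
Proof.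
exists X, Y, f, (roof_of (cid X)), (roof_of (cid Y)), (roof_of (cid (cone f))).
split; first by split; apply: is_iso_id.
split.
- exists (roof_of f); split.
    by solve_is_comp (cid X) (f) (cid X).
  by solve_is_comp (cid X) (cid X) (cid X).
- exists (roof_of (cone_in f)); split.
    by solve_is_comp (cid Y) (cone_in f) (cid Y).
  by solve_is_comp (cid Y) (cid Y) (cid Y).
- exists (roof_of (cone_out f)); split.
    by solve_is_comp (cid (cone f)) (cone_out f) (cid (cone f)).
  by solve_is_comp (cid (cone f)) (cid (cone f)) (cid (cone f)).
Qed.

End Roofs.

Section Shifts.
Variables (k : fieldType) (s : bool) (X : cplx k) (m : int).

Lemma shift_cyc i v (x : X (i + m) v) : cyc (x : shift m X i v) <-> cyc x.
Proof.
have sc0 (V : lmodType k) (y : V) : (-1) ^+ `|m|%N *: y = 0 -> y = 0.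
  by move/eqP; rewrite scaler_eq0 signr_eq0 => /eqP.
split=> cx; last by move=> l e; rewrite /= scale_lfunE cx scaler0.
apply: (cycP (e := shift_deg m (erefl (i + 1)))).
by have := cx _ (erefl (i + 1)); rewrite /= scale_lfunE => /sc0.
Qed.

Lemma shift_bnd i v (x : X (i + m) v) : bnd (x : shift m X i v) <-> bnd x.
Proof.
split=> [[h [e [y ->]]] | bx].
  by rewrite /= scale_lfunE; apply/bndZ/bnd_diff.
have e : i - 1 + 1 = i by rewrite subrK.
have [y ->] := bndP (shift_deg m e) bx.
exists (i - 1), e, ((-1) ^+ `|m|%N *: y : X (i - 1 + m) v).
by rewrite /= scale_lfunE lfunZ scalerA -expr2 sqrr_sign scale1r.
Qed.

Lemma coh_vanish_shift j : coh_vanish (shift m X) j <-> coh_vanish X (j + m).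
Proof.
by rewrite !coh_vanishP; split=> H v x; [move/shift_cyc/H/shift_bnd | move/shift_cyc/H/shift_bnd].
Qed.

Lemma reduced_shift n : reduced s n (shift m X) <-> reduced s (n + m) X.
Proof.
split=> -[X0 Xd]; split=> [j lt_j | v x [N [cN aN bN] Nx]].
- have [j' jE] : exists j', j = j' + m by exists (j - m); rewrite subrK.
  by rewrite jE; apply/coh_vanish_shift/X0; lia.
- apply/shift_bnd/Xd; exists N => //; split=> [u y /cN/shift_cyc // | // | y /bN [z Nz b]].
  by exists z => //; apply/shift_bnd; case: s b.
- by apply/coh_vanish_shift/X0; lia.
- apply/shift_bnd/Xd; exists N => //; split=> [u y /cN/shift_cyc // | // | y /bN [z Nz b]].
  by exists z => //; move/shift_bnd: b; case: s.
Qed.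
End Shifts.

Section Induced.
Variables (k : fieldType) (s : bool) (E : rep k).
Hypothesis orthE : forall X : cplx k, left_orth (stalk E) X <-> tot_acyclic s X.
Implicit Types X Y Z : cplx k.
Let C := left_orth (stalk E).
Let t := conn_induced (std_tstructure k) C.

Lemma tleP X : tle t X <-> (forall j, 0 < j -> coh_vanish X j) /\ tot_acyclic s X.
Proof. by rewrite /= -orthE. Qed.

Lemma tgeP X : tge t X <-> tot_acyclic s X /\ reduced s (-1) X.
Proof.
split=> [[/orthE aX H] | [aX rX]]; split=> //.
- by apply: reduced_of_hom_zero => // Y Y0 /orthE aY; apply: H.
- exact/orthE.
move=> Y [Y0 /orthE aY]; apply: (hom_zero_reduced (n := -1) (s := s)) => //.
  exact: tot_acyclic_shift.
by move=> j lt_j; apply/coh_vanish_shift/Y0; lia.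
Qed.

Lemma tot_acyclic_iso X Y : isomorphic X Y -> tot_acyclic s X -> tot_acyclic s Y.
Proof.
move=> /isomorphic_span [Z [q [r [qq qr]]]] aX.
exact: tot_acyclic_qis_cod qr (tot_acyclic_qis_dom qq aX).
Qed.

(** A cocycle (p, x) of the cone with x in A is the coboundary of
    (x, 0).  In degree 0 one has p = 0, and the second components of divisible
    classes, together with [dpart], form a divisible family of [X], hence lie in
    A. *)
Lemma reduced_cone X : tot_acyclic s X -> reduced s 0 (cone (dtrunc_in s X 0)).
Proof.
set u := dtrunc_in s X 0 => aX.
have cyc_bnd i v (x : X i v) (p : dtrunc s X 0 (i + 1) v) :
    (exists w, u i v w = x) -> cyc (in_cone u p x) -> bnd (in_cone u p x).
  move=> [w wx] /in_cone_cyc [_ dx].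
  have e : i - 1 + 1 = i by rewrite subrK.
  move: x p w wx dx; rewrite -e => x p w wx dx.
  exists (i - 1), erefl, (in_cone u w 0).
  rewrite cone_diffE wx lfun0 addr0; congr in_cone.
  apply: (@trunc_inj _ _ _ (dlayer s X 0)).
  rewrite -[trunc_in _ _ _ p]opprK -[trunc_in _ _ _ p]/(u _ _ p) -dx lfunN.
  by rewrite -[trunc_in _]/u cmE wx.
split=> [j lt_j | v [p x] dx].
  apply/coh_vanishP => v [p x]; apply: cyc_bnd.
  exact: (trunc_lt (dlayer s X 0) x lt_j).
apply: cyc_bnd; last exact: dpart_cyc dx.
apply: (trunc_n (K := dlayer s X 0)); apply/mem_dlayer.
have cyc_snd w (d : cone u 0 w) : cyc d -> cyc d.2.
  case: d => q y /in_cone_cyc [_ dy]; apply: (cycP (e := erefl)); rewrite dy.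
  by rewrite (_ : q = 0) ?lfunN ?lfun0 ?oppr0 //; apply: (@trunc_gt _ _ _ (dlayer s X 0)).
have act_snd al (d : cone u 0 (src al)) : (act (cone u 0) al d).2 = act (X 0) al d.2.
  by rewrite /= lpairE /= comp_lfunE lsndE.
have fb_snd (d : cone u 0 v2) : (fb s (cone u 0) d).2 = fb s (X 0) d.2.
  by case: d => q y; rewrite -/(in_cone u q y) cone_fbE.
have [cD aD bD] := dpart_divisible s (cone u) 0.
have [cX aX' bX] := dpart_divisible s X 0.
exists (fun w (y : X 0 w) => exists (d : cone u 0 w) z,
    [/\ dpart s d, dpart s z & y = d.2 + z]).
  split=> [w _ [d [z [/cD/cyc_snd cd /cX cz ->]]] | al _ [d [z [/aD dd /aX' dz ->]]]
          | _ [d [z [/bD [d' dd' bd] /bX [z' dz' bz] ->]]]].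
  - exact: cycD.
  - by do 2!eexists; split; [exact: dd | exact: dz | rewrite lfunD act_snd].
  - have [q] := bnd_cone bd; rewrite [(_ - _).2]/= fb_snd => bq.
    have [|z'' dz'' bz''] := bX (u 0 v3 q); first by apply/mem_dlayer/trunc_n_mem.
    exists (d'.2 + (z' + z'')).
      exists d', (z' + z''); split=> //; rewrite -[z']scale1r; exact: dpart_lin.
    have -> : d.2 + z - fb s (X 0) (d'.2 + (z' + z'')) =
        (d.2 - fb s (X 0) d'.2 - u 0 v3 q) + (z - fb s (X 0) z') +
        (u 0 v3 q - fb s (X 0) z'') by rewrite !lfunL; abel.
    by apply: bndD => //; apply: bndD.
exists (p, x), 0; split; rewrite ?addr0 //; exact/bnd_dpart/bnd0.
Qed.

Lemma connectively_induces_orth : connectively_induces (std_tstructure k) C.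
Proof.
split.
- by split=> X []; rewrite ?/C.
- split=> X Y iXY.
    move=> /tleP [X0 aX]; apply/tleP; split; last exact: tot_acyclic_iso iXY aX.
    have [Z [q [r [qq qr]]]] := isomorphic_span iXY.
    by move=> j /X0; rewrite -(coh_vanish_qis j qq) (coh_vanish_qis j qr).
  move=> /tgeP [aX rX]; apply/tgeP; split; first exact: tot_acyclic_iso iXY aX.
  have [Z [q [r [qq qr]]]] := isomorphic_span iXY.
  exact: reduced_qis_cod qr (reduced_qis_dom qq rX).
- split=> X.
    move=> /tleP [X0 aX]; apply/tleP; split; last exact: tot_acyclic_shift.
    by move=> j lt_j; apply/coh_vanish_shift/X0; lia.
  move=> /tgeP [aX [X0 _]]; apply/tgeP; split; first exact: tot_acyclic_shift.
  apply/reduced_shift; split=> [j lt_j | v x dx]; first by apply: X0; lia.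
  apply: (proj1 (coh_vanishP _ _)); first by apply: X0; lia.
  exact: dpart_cyc dx.
- move=> X Y /tleP [X0 aX] _ /tgeP [_ /reduced_shift rY].
  exact: (hom_zero_reduced aX X0 rY).
- move=> X /orthE aX; set u := dtrunc_in s X 0.
  exists (dtrunc s X 0), (cone u), (roof_of u), (roof_of (cone_in u)), (roof_of (cone_out u)).
  have aA := tot_acyclic_dtrunc (n := 0) aX; have aB := tot_acyclic_cone (f := u) aA aX.
  split; last exact: cone_distinguished.
  + by apply/tleP; split=> // j lt_j; apply: trunc_coh_vanish.
  + exact/orthE.
  + apply/tgeP; split; first exact: tot_acyclic_shift.
    by apply/reduced_shift/reduced_cone.
Qed.

Lemma bounded_orth : bounded_tstructure C t.
Proof.
move=> X /orthE aX; have [N bN] := ob_bounded X.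
exists (- N%:Z), N%:Z; split.
  apply/tgeP; split; first exact: tot_acyclic_shift.
  apply/reduced_shift; split=> [j lt_j | v x dx].
    by apply/coh_vanishP => v x _; rewrite (bN j v x); [apply: bnd0 | lia].
  by rewrite (bN _ v x); [apply: bnd0 | lia].
apply/tleP; split; last exact: tot_acyclic_shift.
move=> j lt_j; apply/coh_vanish_shift/coh_vanishP => v x _.
by rewrite (bN _ v x); [apply: bnd0 | lia].
Qed.

End Induced.

(** * A resolution adapted to Tot *)

Section Builders.
Variable k : fieldType.

Section Rep.
Variables (V : vertex -> vectType k) (al : bool -> 'Hom(V v1, V v2))
  (be : bool -> 'Hom(V v2, V v3)).
Hypothesis beal : forall t x, be t (al t x) = 0.

Definition mkrep : rep k.
Proof.
refine (@Rep k V (fun ar => match ar return 'Hom(V (src ar), V (tgt ar)) with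
  | a1 => al true | a2 => al false | b1 => be false | b2 => be true end) _ _);
by apply/lfunP=> x; rewrite comp_lfunE zero_lfunE beal.
Defined.

Lemma fa_mkrep t x : fa t mkrep x = al t x. Proof. by case: t. Qed.
Lemma fb_mkrep t x : fb t mkrep x = be t x. Proof. by case: t. Qed.
End Rep.

Definition mkrhom (M N : rep k) (f : forall v, 'Hom(M v, N v))
  (fa_f : forall t x, f v2 (fa t M x) = fa t N (f v1 x))
  (fb_f : forall t x, f v3 (fb t M x) = fb t N (f v2 x)) : rhom M N.
Proof.
refine (@RHom k M N f _); case; apply/lfunP=> x; rewrite !comp_lfunE.
- exact: (fa_f true).
- exact: (fa_f false).
- exact: (fb_f false).
- exact: (fb_f true).
Defined.

Section Complex.
Variables (M : int -> rep k) (d : forall i, rhom (M i) (M (i + 1))).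
Hypothesis dd : forall i v x, d (i + 1) v (d i v x) = 0.
Hypothesis M_bounded : exists N : nat, forall (i : int) (v : vertex) (x : M i v),
  (N < `|i|)%N -> x = 0.

Definition mkdiff i j (e : i + 1 = j) : rhom (M i) (M j) :=
  match e in _ = j0 return rhom (M i) (M j0) with erefl => d i end.

Definition mkcplx : cplx k.
Proof.
refine (@Cplx k M mkdiff _ M_bounded) => i j l e e' v.
by case: _ / e'; case: _ / e; apply/lfunP=> x; rewrite comp_lfunE zero_lfunE dd.
Defined.

Definition mkcmap_to (Y : cplx k) (f : forall i, rhom (M i) (Y i))
  (df : forall i v x, f (i + 1) v (d i v x) = diff Y erefl v (f i v x)) :
  cmap mkcplx Y.
Proof.
refine (@CMap k mkcplx Y f _) => i j e v.
by case: _ / e; apply/lfunP=> x; rewrite !comp_lfunE df.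
Defined.

End Complex.

End Builders.

Section Resolution.
Variables (k : fieldType) (s : bool) (X : cplx k).
Local Notation a := (fa s _).
Local Notation b := (fb s _).
Local Notation a' := (fa (~~ s) _).
Local Notation b' := (fb (~~ s) _).
Local Notation p1 := (lfst _ _).
Local Notation p2 := (lsnd _ _).

(** Contractible complexes are added to X at the vertices 2 and 3.  At 2 it is
    the cone of the identity of X_1, which makes [a] injective.  At 3 it is the
    cone of the identity of res_2 / a res_1, in which [b] now embeds that
    quotient; the quotient is X_2 (+) X_1[1] through (x, (y, z)) |-> (x - a y, z).
    Dividing the space at 3 by the image of [b] leaves X_3, X_2[1] and X_1[2],
    that is Tot X. *)
Definition res_sp (i : int) (v : vertex) : vectType k :=
  match v return vectType k with
  | v1 => X i v1
  | v2 => (X i v2 * (X i v1 * X (i + 1)%R v1))%type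
  | v3 => (X i v3 * ((X i v2 * X (i + 1)%R v1) * (X (i + 1)%R v2 * X (i + 1 + 1)%R v1)))%type
  end.

Definition res_alpha (i : int) (t : bool) : 'Hom(res_sp i v1, res_sp i v2) :=
  if t == s then lpair (fa s (X i)) (lpair \1%VF 0)
  else lpair (fa (~~ s) (X i)) (lpair 0 0).

Definition res_beta (i : int) (t : bool) : 'Hom(res_sp i v2, res_sp i v3) :=
  if t == s then
    lpair (fb s (X i) \o p1)%VF
      (lpair (lpair (p1 - (fa s (X i) \o p1 \o p2)%VF) (p2 \o p2)%VF) (lpair 0 0))
  else lpair (fb (~~ s) (X i) \o p1)%VF (lpair (lpair 0 0) (lpair 0 0)).

Definition lfun_simp := (lpairE, lfstE, lsndE, comp_lfunE, add_lfunE, opp_lfunE,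
  zero_lfunE, id_lfunE).

Lemma res_alpha_s i x : res_alpha i s x = (a x, (x, 0)).
Proof. by rewrite /res_alpha eqxx !lfun_simp. Qed.

Lemma negb_eq_self t : (~~ t == t) = false. Proof. by case: t. Qed.

Lemma res_alpha_n i x : res_alpha i (~~ s) x = (a' x, (0, 0)).
Proof. by rewrite /res_alpha negb_eq_self !lfun_simp. Qed.

Lemma res_beta_s i x y z : res_beta i s (x, (y, z)) = (b x, ((x - a y, z), (0, 0))).
Proof. by rewrite /res_beta eqxx !lfun_simp /=. Qed.

Lemma res_beta_n i x y : res_beta i (~~ s) (x, y) = (b' x, ((0, 0), (0, 0))).
Proof. by rewrite /res_beta negb_eq_self !lfun_simp. Qed.

Lemma bool_ind_s (P : bool -> Prop) : P s -> P (~~ s) -> forall t, P t.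
Proof. by case: s => /= ? ? []. Qed.

Lemma res_beta_alpha i t x : res_beta i t (res_alpha i t x) = 0.
Proof.
elim/bool_ind_s: t.
  by rewrite res_alpha_s res_beta_s fbfa subrr.
by rewrite res_alpha_n res_beta_n fbfa.
Qed.

Definition res_rep i : rep k := mkrep (@res_beta_alpha i).

Definition res_d2 i : 'Hom(res_sp i v2, res_sp (i + 1) v2) :=
  lpair (diff X erefl v2 \o p1)%VF
    (lpair ((diff X erefl v1 \o p1 \o p2)%VF + (p2 \o p2)%VF)
           (- (diff X erefl v1 \o p2 \o p2)%VF)).

Definition res_d3 i : 'Hom(res_sp i v3, res_sp (i + 1) v3) :=
  lpair (diff X erefl v3 \o p1)%VF
    (lpair
      (lpair ((diff X erefl v2 \o p1 \o p1 \o p2)%VF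
              - (fa s (X (i + 1)) \o p2 \o p1 \o p2)%VF + (p1 \o p2 \o p2)%VF)
             (- (diff X erefl v1 \o p2 \o p1 \o p2)%VF + (p2 \o p2 \o p2)%VF))
      (lpair (- (diff X erefl v2 \o p1 \o p2 \o p2)%VF
              + (fa s (X (i + 1 + 1)) \o p2 \o p2 \o p2)%VF)
             (diff X erefl v1 \o p2 \o p2 \o p2)%VF)).

Definition res_dsp i v : 'Hom(res_sp i v, res_sp (i + 1) v) :=
  match v return 'Hom(res_sp i v, res_sp (i + 1) v) with
  | v1 => diff X erefl v1 | v2 => res_d2 i | v3 => res_d3 i end.

Lemma res_d2E i x y z : res_dsp i v2 (x, (y, z)) =
  (diff X erefl v2 x, (diff X erefl v1 y + z, - diff X erefl v1 z)).
Proof. by rewrite /= /res_d2 !lfun_simp. Qed.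

Lemma res_d3E i x p t p' t' : res_dsp i v3 (x, ((p, t), (p', t'))) =
  (diff X erefl v3 x,
    ((diff X erefl v2 p - a t + p', - diff X erefl v1 t + t'),
     (- diff X erefl v2 p' + a t', diff X erefl v1 t'))).
Proof. by rewrite /= /res_d3 !lfun_simp. Qed.

Lemma res_d_alpha i t x : res_dsp i v2 (res_alpha i t x) = res_alpha (i + 1) t (res_dsp i v1 x).
Proof.
elim/bool_ind_s: t.
  by rewrite !res_alpha_s res_d2E rmap_fa !lfunL addr0 oppr0.
by rewrite !res_alpha_n res_d2E rmap_fa !lfunL addr0 oppr0.
Qed.

Lemma res_d_beta i t x : res_dsp i v3 (res_beta i t x) = res_beta (i + 1) t (res_dsp i v2 x).
Proof.
case: x => [x [y z]]; elim/bool_ind_s: t.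
  rewrite res_beta_s res_d3E res_d2E res_beta_s !lfunL rmap_fb rmap_fa.
  by do ![congr pair]; abel.
rewrite res_beta_n res_d3E res_d2E res_beta_n !lfunL rmap_fb.
by rewrite !(oppr0, addr0).
Qed.

Definition res_d i : rhom (res_rep i) (res_rep (i + 1)).
Proof.
apply: (@mkrhom k (res_rep i) (res_rep (i + 1)) (res_dsp i)) => t x.
  by rewrite !fa_mkrep res_d_alpha.
by rewrite !fb_mkrep res_d_beta.
Defined.

Lemma res_d_v1 i x : res_d i v1 x = diff X erefl v1 x.
Proof. by []. Qed.

Lemma res_d_v2 i x y z : res_d i v2 (x, (y, z)) =
  (diff X erefl v2 x, (diff X erefl v1 y + z, - diff X erefl v1 z)).
Proof. exact: res_d2E. Qed.

Lemma res_d_v3 i x p t p' t' : res_d i v3 (x, ((p, t), (p', t'))) =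
  (diff X erefl v3 x,
    ((diff X erefl v2 p - a t + p', - diff X erefl v1 t + t'),
     (- diff X erefl v2 p' + a t', diff X erefl v1 t'))).
Proof. exact: res_d3E. Qed.

Lemma res_dd i v x : res_d (i + 1) v (res_d i v x) = 0.
Proof.
case: v x => [x | [x [y z]] | [x [[p t] [p' t']]]].
- exact: diffKE.
- rewrite !res_d_v2 !lfunL !diffKE !oppr0; do ![congr pair] => //.
  by rewrite add0r subrr.
- rewrite !res_d_v3 !lfunL !diffKE -!rmap_fa; do ![congr pair] => //; abel.
Qed.

Lemma fa_res i t x : fa t (res_rep i) x = res_alpha i t x.
Proof. exact: fa_mkrep. Qed.
Lemma fb_res i t x : fb t (res_rep i) x = res_beta i t x.
Proof. exact: fb_mkrep. Qed.

Lemma res_bounded : exists N : nat, forall (i : int) (v : vertex) (x : res_rep i v),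
  (N < `|i|)%N -> x = 0.
Proof.
have [N bN] := ob_bounded X; exists N.+2 => i v x lt_i.
have X0 w (y : X i w) : y = 0 by apply: bN; lia.
have X1 w (y : X (i + 1) w) : y = 0 by apply: bN; lia.
have X2 w (y : X (i + 1 + 1) w) : y = 0 by apply: bN; lia.
case: v x => [x | [x [y z]] | [x [[p t] [p' t']]]].
- exact: X0.
- by rewrite [x]X0 [y]X0 [z]X1.
- by rewrite [x]X0 [p]X0 [t]X1 [p']X1 [t']X2.
Qed.

Definition res : cplx k := mkcplx res_dd res_bounded.

Definition res_out_sp i v : 'Hom(res_sp i v, X i v) :=
  match v return 'Hom(res_sp i v, X i v) with
  | v1 => \1%VF | v2 => p1 | v3 => p1 end.

Definition res_out_rep i : rhom (res_rep i) (X i).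
Proof.
apply: (@mkrhom k (res_rep i) (X i) (res_out_sp i)) => t x.
  rewrite fa_mkrep; elim/bool_ind_s: t; by rewrite ?res_alpha_s ?res_alpha_n !lfun_simp.
rewrite fb_mkrep; case: x => [x [y z]].
by elim/bool_ind_s: t; rewrite ?res_beta_s ?res_beta_n !lfun_simp.
Defined.

Lemma res_out_v1 i x : res_out_rep i v1 x = x.
Proof. by rewrite /= id_lfunE. Qed.
Lemma res_out_v2 i x y : res_out_rep i v2 (x, y) = x.
Proof. by rewrite /= lfstE. Qed.
Lemma res_out_v3 i x y : res_out_rep i v3 (x, y) = x.
Proof. by rewrite /= lfstE. Qed.

Definition res_out : cmap res X.
Proof.
apply: (mkcmap_to _ _ (f := res_out_rep)) => i v x.
case: v x => [x | [x [y z]] | [x [[p t] [p' t']]]].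
- by rewrite res_d_v1 !res_out_v1.
- by rewrite res_d_v2 !res_out_v2.
- by rewrite res_d_v3 !res_out_v3.
Defined.

Lemma res_out_quasi_iso : quasi_iso res_out.
Proof.
apply/quasi_isoP; split=> j v x.
- move=> cx [h [e [z E]]]; case: _ / e x cx E => x /(_ _ erefl) cx E.
  suff [y ->] : exists y, x = res_d h v y by exists h, erefl, y.
  case: v z x cx E => z.
  + by move=> x _; rewrite res_out_v1 => ->; exists z.
  + move=> [x [y t]]; rewrite [diff _ _ _ _]res_d_v2 res_out_v2 => -[_ dy _] ->.
    exists (z, (0, y)); rewrite res_d_v2 lfun0 add0r; do ![congr pair].
    by rewrite -[t](addKr (diff X erefl v1 y)) dy addr0.
  + move=> [x [[p t] [p' t']]]; rewrite [diff _ _ _ _]res_d_v3 res_out_v3.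
    move=> -[_ dp dt _ _] ->.
    exists (z, ((0, 0), (p, t))); rewrite res_d_v3 !lfun0 oppr0 !add0r.
    do ![congr pair]; first by rewrite oppr0 add0r.
      by rewrite -[p'](addKr (diff X erefl v2 p - a t)) dp; abel.
    by rewrite -[t'](addKr (- diff X erefl v1 t)) dt; abel.
- move=> cx; case: v x cx => x cx.
  + exists x; last by rewrite res_out_v1 subrr; apply: bnd0.
    by apply: (cycP (e := erefl)); apply: cx.
  + exists (x, (0, 0)); last by rewrite res_out_v2 subrr; apply: bnd0.
    apply: (cycP (e := erefl)).
    by rewrite [diff _ _ _ _]res_d_v2 cx !lfun0 addr0 oppr0.
  + exists (x, ((0, 0), (0, 0))); last by rewrite res_out_v3 subrr; apply: bnd0.
    apply: (cycP (e := erefl)).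
    by rewrite [diff _ _ _ _]res_d_v3 cx !lfun0 !(addr0, oppr0).
Qed.

Definition tot i : vectType k :=
  (X (i + 1 + 1)%R v1 * (X (i + 1)%R v2 * X i v3))%type.

Definition tot_d i : 'Hom(tot i, tot (i + 1)) :=
  lpair (diff X erefl v1 \o p1)%VF
    (lpair ((fa s (X (i + 1 + 1)) \o p1)%VF - (diff X erefl v2 \o p1 \o p2)%VF)
           ((diff X erefl v3 \o p2 \o p2)%VF - (fb s (X (i + 1)) \o p1 \o p2)%VF)).

Lemma tot_dE i y1 y2 y3 : tot_d i (y1, (y2, y3)) =
  (diff X erefl v1 y1, (a y1 - diff X erefl v2 y2, diff X erefl v3 y3 - b y2)).
Proof. by rewrite /tot_d !lfun_simp. Qed.

(** The quotient of res_3 by b res_2, identified with Tot X. *)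
Definition res_tot i : 'Hom(res i v3, tot i) :=
  lpair (p2 \o p2 \o p2)%VF
    (lpair (p1 \o p2 \o p2)%VF (p1 - (fb s (X i) \o p1 \o p1 \o p2)%VF)).

Lemma res_totE i x p t p' t' :
  res_tot i (x, ((p, t), (p', t'))) = (t', (p', x - b p)).
Proof. by rewrite /res_tot !lfun_simp. Qed.

Lemma res_tot_d i z : res_tot (i + 1) (res_d i v3 z) = tot_d i (res_tot i z).
Proof.
case: z => [x [[p t] [p' t']]]; rewrite res_d_v3 !res_totE tot_dE.
rewrite !lfunL fbfa rmap_fb; do ![congr pair]; abel.
Qed.

Lemma res_tot_fb i z : res_tot i (fb s (res i) z) = 0.
Proof.
case: z => [x [y t]]; rewrite fb_res res_beta_s res_totE !lfunL fbfa.
by do ![congr pair]; abel.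
Qed.

Lemma tot_d_cocycle i z1 z2 z3 : tot_d i (z1, (z2, z3)) = 0 ->
  tot_cocycle (X := X) s (erefl (i + 1)) (erefl (i + 1 + 1)) z1 z2 z3.
Proof.
rewrite tot_dE => -[d1 /eqP d2 /eqP d3]; split; first exact: cycP d1.
  by apply/esym/eqP; rewrite -subr_eq0.
by apply/eqP; rewrite -subr_eq0.
Qed.

Lemma tot_acyclicP : tot_acyclic s X <->
  forall i z, tot_d (i + 1) z = 0 -> exists y, z = tot_d i y.
Proof.
split=> aX.
  move=> i [z1 [z2 z3]] /tot_d_cocycle /aX [y1 [y2 [-> -> /(bndP erefl)[y3 E3]]]].
  exists (y1, (y2, y3)); rewrite tot_dE -E3; do ![congr pair]; abel.
move=> i j l; have [h ->] : exists h, i = h + 1 by exists (i - 1); rewrite subrK.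
move=> e e'; case: _ / e'; case: _ / e => x1 x2 x3 [c1 d2 d3].
have [|[y1 [y2 y3]]] := aX h (x1, (x2, x3)).
  by rewrite tot_dE c1 d2 d3 !subrr.
rewrite tot_dE => -[E1 E2 E3]; exists y1, y2; split=> //.
by rewrite E3 subrK; apply: bnd_diff.
Qed.

End Resolution.

(** * Membership in the component as acyclicity of Tot *)

Section LinearForms.
Variables (k : fieldType).

Lemma factor_lfun (V W U : vectType k) (f : 'Hom(V, W)) (g : 'Hom(V, U)) x :
  (forall y, f y = 0 -> g y = 0) -> (g \o f^-1)%VF (f x) = g x.
Proof.
move=> gf; rewrite comp_lfunE; apply/eqP; rewrite -subr_eq0 -linearB; apply/eqP.
by apply: gf; rewrite linearB /= limg_lfunVK ?subrr // memv_img // memvf.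
Qed.

Lemma separating_form (V : vectType k) (U : {vspace V}) z : z \notin U ->
  exists th : 'Hom(V, k^o), (forall x, x \in U -> th x = 0) /\ th z != 0.
Proof.
move=> zU; pose w := z - projv U z.
have w0 : w != 0.
  by apply: contra zU; rewrite subr_eq0 => /eqP->; apply: memv_proj.
have [j wj] : exists j, coord (vbasis fullv) j w != 0.
  apply/existsP; apply: contraR w0; rewrite negb_exists => /forallP w0.
  rewrite (coord_vbasis (memvf w)) big1 // => i _.
  by have := w0 i; rewrite negbK => /eqP->; rewrite scale0r.
exists (linfun (coord (vbasis fullv) j : V -> k^o) \o (\1 - projv U))%VF.
split=> [x xU |]; rewrite comp_lfunE lfunE add_lfunE opp_lfunE id_lfunE //.
by rewrite projv_id // subrr linear0.
Qed.
End LinearForms.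

Definition E_sign (k : fieldType) (s : bool) : rep k := if s then E_plus k else E_minus k.

Section Sign.
Variables (k : fieldType) (s : bool).

Definition lift_sp (M : rep k) (w : 'Hom(M v3, k^o)) v : 'Hom(M v, k^o) :=
  match v return 'Hom(M v, k^o) with
  | v3 => w | v2 => (w \o fb (~~ s) M)%VF | v1 => (w \o fb (~~ s) M \o fa s M)%VF
  end.

(** The spaces of [E_sign k s] are all equal to k, but not by computation as
    long as [s] is a variable. *)
Definition E_coord v : 'Hom(E_sign k s v, k^o) :=
  if s as s0 return 'Hom(E_sign k s0 v, k^o) then \1%VF else \1%VF.
Definition E_of_coord v : 'Hom(k^o, E_sign k s v) :=
  if s as s0 return 'Hom(k^o, E_sign k s0 v) then \1%VF else \1%VF.

Lemma E_of_coordK v x : E_coord v (E_of_coord v x) = x.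
Proof. by rewrite /E_coord /E_of_coord; case: s; rewrite /= !id_lfunE. Qed.
Lemma E_coordK v x : E_of_coord v (E_coord v x) = x.
Proof. by move: x; rewrite /E_coord /E_of_coord; case: s => x; rewrite /= !id_lfunE. Qed.

Lemma E_fa x : E_coord v2 (fa s (E_sign k s) x) = E_coord v1 x.
Proof. by move: x; rewrite /E_coord; case: s => x; rewrite /= !id_lfunE. Qed.
Lemma E_fa_n x : fa (~~ s) (E_sign k s) x = 0.
Proof. by move: x; rewrite /E_coord; case: s => x; rewrite /= zero_lfunE. Qed.
Lemma E_fb x : fb s (E_sign k s) x = 0.
Proof. by move: x; rewrite /E_coord; case: s => x; rewrite /= zero_lfunE. Qed.
Lemma E_fb_n x : E_coord v3 (fb (~~ s) (E_sign k s) x) = E_coord v2 x.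
Proof. by move: x; rewrite /E_coord; case: s => x; rewrite /= !id_lfunE. Qed.

Lemma E_coord_inj v : injective (E_coord v).
Proof. by move=> x y Exy; rewrite -[x]E_coordK Exy E_coordK. Qed.

(** Maps to E are the linear forms on M_3 that kill b M_2: the components at 2 and
    1 are forced, since b' and a are identities on E, and the other two squares
    commute because b' a' = 0 and w b = 0. *)
Definition E_lift (M : rep k) (w : 'Hom(M v3, k^o))
  (w0 : forall x, w (fb s M x) = 0) : rhom M (E_sign k s).
Proof.
apply: (@mkrhom k M (E_sign k s) (fun v => (E_of_coord v \o lift_sp w v)%VF)) => t x;
  rewrite !comp_lfunE; elim/(bool_ind_s (s := s)): t.
- by apply: E_coord_inj; rewrite E_fa !E_of_coordK /= ?comp_lfunE.
- by rewrite E_fa_n /= ?comp_lfunE fbfa !lfun0.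
- by rewrite E_fb /= w0 lfun0.
- by apply: E_coord_inj; rewrite E_fb_n !E_of_coordK /= ?comp_lfunE.
Defined.

Lemma E_liftE (M : rep k) (w : 'Hom(M v3, k^o)) (w0 : forall x, w (fb s M x) = 0) x :
  E_coord v3 (E_lift w0 v3 x) = w x.
Proof. by rewrite /= comp_lfunE E_of_coordK. Qed.

Lemma E_ext (M : rep k) (f g : rhom M (E_sign k s)) :
  (forall x, E_coord v3 (f v3 x) = E_coord v3 (g v3 x)) -> forall v x, f v x = g v x.
Proof.
move=> fg v x; apply: E_coord_inj; have fg2 y : E_coord v2 (f v2 y) = E_coord v2 (g v2 y).
  by rewrite -!E_fb_n -!rmap_fb fg.
by case: v x => x //; rewrite -!E_fa -!rmap_fa fg2.
Qed.

Let E := E_sign k s.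

(** With [stalk_out], identifies the component of a shifted stalk complex that is
    not zero with E, uniformly in the degree. *)
Definition stalk_in (c : bool) : rhom E (if c then E else rep0 k) :=
  if c as c0 return rhom E (if c0 then E else rep0 k) then rid E else rzero _ _.
Definition stalk_out (c : bool) : rhom (if c then E else rep0 k) E :=
  if c as c0 return rhom (if c0 then E else rep0 k) E then rid E else rzero _ _.

Lemma stalk_outK c v x : stalk_in c v (stalk_out c v x) = x.
Proof.
case: c x => x; first by rewrite /= !id_lfunE.
by apply/rowP; case.
Qed.

Lemma stalk_inK (c : bool) v x : c -> stalk_out c v (stalk_in c v x) = x.
Proof. by case: c => //= _; rewrite !id_lfunE. Qed.

Lemma stalk_diff n i j (e : i + 1 = j) v x : diff (shift n (stalk E)) e v x = 0.
Proof. by rewrite /= scale_lfunE zero_lfunE scaler0. Qed.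

Definition form_at (Z : cplx k) n (g : cmap Z (shift n (stalk E))) i : 'Hom(Z i v3, k^o) :=
  (E_coord v3 \o stalk_out (i + n == 0) v3 \o g i v3)%VF.

Lemma form_at_fb (Z : cplx k) n (g : cmap Z (shift n (stalk E))) i x :
  form_at g i (fb s (Z i) x) = 0.
Proof. by rewrite !comp_lfunE !rmap_fb E_fb lfun0. Qed.

Lemma form_at_diff (Z : cplx k) n (g : cmap Z (shift n (stalk E))) i x :
  form_at g (i + 1) (diff Z erefl v3 x) = 0.
Proof. by rewrite !comp_lfunE (cmE g) stalk_diff !lfun0. Qed.

(** The numerator g of a roof is a linear form on Tot of its apex Z that vanishes
    on cocycles; so it factors as psi o D through the differential D of Tot Z, and psi
    is a null-homotopy of g on [res Z]. *)
Lemma hom_zero_of_tot_acyclic (X : cplx k) n : tot_acyclic s X -> hom_zero X (shift n (stalk E)).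
Proof.
move=> aX; apply/hom_zeroP => Z q g qq.
have /tot_acyclicP aZ := tot_acyclic_qis_dom qq aX.
pose gam i : 'Hom(tot Z i, k^o) := (form_at g i \o lsnd _ _ \o lsnd _ _)%VF.
have gamE i y1 y2 y3 : gam i (y1, (y2, y3)) = form_at g i y3.
  by rewrite 2!comp_lfunE !lsndE.
have gam0 i : forall y, tot_d s Z i y = 0 -> gam i y = 0.
  have [h ->] : exists h, i = h + 1 by exists (i - 1); rewrite subrK.
  move=> _ /aZ [[y1 [y2 y3]] ->]; rewrite tot_dE gamE.
  by rewrite lfunD lfunN form_at_fb form_at_diff subr0.
pose psi i := (gam i \o (tot_d s Z i)^-1)%VF.
have psi_fb i x : (psi i \o res_tot s Z (i + 1))%VF (fb s (res s Z (i + 1)) x) = 0.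
  by rewrite comp_lfunE res_tot_fb lfun0.
pose h i j (e : i + 1 = j) : rhom (res s Z j) (shift n (stalk E) i) :=
  match e in _ = j0 return rhom (res s Z j0) (shift n (stalk E) i) with
  | erefl => rcomp (stalk_in (i + n == 0)) (E_lift (psi_fb i))
  end.
exists (res s Z), (res_out s Z); split; first exact: res_out_quasi_iso.
exists h => i j l e e' v; apply/lfunP=> x.
rewrite add_lfunE opp_lfunE add_lfunE zero_lfunE subr0 2!comp_lfunE stalk_diff add0r.
case: _ / e'; rewrite [LHS]comp_lfunE [RHS]comp_lfunE -[LHS]stalk_outK.
congr (stalk_in _ _ _).
pose F1 := rcomp (stalk_out (j + n == 0)) (rcomp (g j) (res_out s Z j)).
pose F2 := rcomp (E_lift (psi_fb j)) (diff (res s Z) (erefl (j + 1))).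
have F12 y : E_coord v3 (F1 v3 y) = E_coord v3 (F2 v3 y).
  transitivity (form_at g j (res_out s Z j v3 y)).
    by rewrite /F1 !comp_lfunE.
  rewrite [F2 v3 y]comp_lfunE E_liftE [RHS]comp_lfunE [diff _ _ _ y]/(res_d s Z j v3 y).
  rewrite res_tot_d [RHS]factor_lfun; last exact: gam0.
  case: y => x0 [[p t] [p' t']]; rewrite res_totE res_out_v3.
  by rewrite gamE lfunD lfunN form_at_fb subr0.
by have := E_ext F12 x; rewrite [F1 v x]comp_lfunE [rcomp (g j) _ v x]comp_lfunE [F2 v x]comp_lfunE.
Qed.

Lemma tot_form_family (X : cplx k) i (th : 'Hom(tot X (i + 1), k^o)) :
  (forall y, th (tot_d s X i y) = 0) ->
  exists Th : forall j, 'Hom(tot X j, k^o),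
    Th (i + 1) = th /\ forall j y, Th (j + 1) (tot_d s X j y) = 0.
Proof.
move=> th0.
exists (fun j => match i + 1 =P j with
  | ReflectT e => match e in _ = j0 return 'Hom(tot X j0, k^o) with erefl => th end
  | ReflectF _ => 0 end).
split=> [|j].
  by case: eqP => // e; rewrite (eq_irrelevance e erefl).
case: eqP => [e | _] y; last by rewrite zero_lfunE.
have ij : i = j by apply: (addIr 1).
by move: e y; rewrite -ij => e y; rewrite (eq_irrelevance e erefl) th0.
Qed.

(** On cocycles of Tot (res X), the quotient map from res_3 to Tot X is cohomologous
    to the map induced by [res_out]. *)
Lemma res_tot_cocycle (X : cplx k) i q1 q2 q3 :
  tot_cocycle (X := res s X) s (erefl (i + 1 + 1)) (erefl (i + 1 + 1 + 1)) q1 q2 q3 ->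
  exists y, (res_out s X _ v1 q1, (res_out s X _ v2 q2, res_out s X _ v3 q3)) =
    res_tot s X (i + 1) q3 + tot_d s X i y.
Proof.
case: q2 q3 => [x2 [x y]] [x3 [[p t] [p' t']]] [c1].
rewrite [diff _ _ _ _]res_d_v2 fa_res res_alpha_s => -[_ d1 _].
rewrite [diff _ _ _ _]res_d_v3 fb_res res_beta_s => -[_ d2 d3 _ _].
exists (x - t, (- p, 0)); rewrite res_totE tot_dE.
rewrite res_out_v1 res_out_v2 res_out_v3 -d1 -d3.
have -> : x2 = diff X erefl v2 p - fa s _ t + p' + fa s _ x by rewrite d2; abel.
by rewrite !lfunL; do ![congr pair]; abel.
Qed.

(** A linear form on Tot X separating a cocycle z from the coboundaries is a
    chain map from [res X] to a shift of E.  If it became null-homotopic on some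
    W, then on the third entry w3 of a cocycle of Tot W it would be h (d w3) =
    h (b w2) = b (h w2) = 0, as b is zero on E; but z lifts to such a cocycle. *)
Lemma tot_acyclic_of_orth (X : cplx k) : left_orth (stalk E) X -> tot_acyclic s X.
Proof.
move=> oX; apply/tot_acyclicP => i [z1 [z2 z3]] /tot_d_cocycle cz; set z : tot X (i + 1) := (z1, _).
case: (boolP (z \in limg (tot_d s X i))) => [/memv_imgP [y _ ->] | zim].
  by exists y.
have [th [th0 thz]] := separating_form zim; case/eqP: thz.
have [|Th [Thi Thd]] := @tot_form_family X i th.
  by move=> y; apply: th0; rewrite memv_img // memvf.
pose n := - (i + 1); pose P := res s X.
have Th_fb j x : (Th j \o res_tot s X j)%VF (fb s (P j) x) = 0.
  by rewrite comp_lfunE res_tot_fb lfun0.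
pose g j : rhom (P j) (shift n (stalk E) j) :=
  rcomp (stalk_in (j + n == 0)) (E_lift (Th_fb j)).
have gd j v x : g (j + 1) v (res_d s X j v x) =
    diff (shift n (stalk E)) (erefl (j + 1)) v (g j v x).
  rewrite stalk_diff comp_lfunE.
  have F0 y : E_coord v3 (rcomp (E_lift (Th_fb (j + 1))) (res_d s X j) v3 y) =
      E_coord v3 (rzero (P j) E v3 y).
    rewrite comp_lfunE E_liftE comp_lfunE res_tot_d Thd.
    by rewrite [rzero _ _ _ _]zero_lfunE lfun0.
  have := E_ext F0 x; rewrite comp_lfunE => ->.
  by rewrite [rzero _ _ _ _]zero_lfunE lfun0.
pose G : cmap P (shift n (stalk E)) := mkcmap_to _ _ gd.
have [W [u [qu [h Gu]]]] := proj1 (hom_zeroP _ _) (oX n) _ _ G (res_out_quasi_iso s X).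
have qq : quasi_iso (ccomp (res_out s X) u).
  exact: quasi_iso_comp (res_out_quasi_iso s X).
have [w1 [w2 [w3 [y1 [y2 [[c1 c2 c3] [E1 E2 /(bndP erefl)[y3 E3]]]]]]]] :=
  tot_cocycle_lift qq cz.
have [|y' Ey'] := @res_tot_cocycle X i (u _ _ w1) (u _ _ w2) (u _ _ w3).
  split; first exact: cyc_map.
    by rewrite -cmE c2 rmap_fa.
  by rewrite -cmE c3 rmap_fb.
have zE : z = res_tot s X (i + 1) (u _ _ w3) + tot_d s X i y' + tot_d s X i (y1, (y2, y3)).
  rewrite -Ey' tot_dE -E3 /z E1 E2 /= !comp_lfunE; do ![congr pair]; abel.
have thd y : th (tot_d s X i y) = 0 by apply: th0; rewrite memv_img // memvf.
rewrite zE !lfunD !thd !addr0.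
have := congr1 (fun f : 'Hom(_, _) => f w3) (Gu _ _ _ (subrK 1 (i + 1)) erefl v3).
rewrite add_lfunE opp_lfunE add_lfunE zero_lfunE subr0 2!comp_lfunE stalk_diff add0r.
rewrite c3 rmap_fb [LHS]comp_lfunE [G _ _ _]comp_lfunE.
move/(congr1 (fun y => E_coord v3 (stalk_out (i + 1 + n == 0) v3 y))).
by rewrite stalk_inK ?subrr // E_liftE comp_lfunE Thi rmap_fb E_fb lfun0.
Qed.

Lemma left_orthP (X : cplx k) : left_orth (stalk E) X <-> tot_acyclic s X.
Proof.
by split=> [|aX n]; [apply: tot_acyclic_of_orth | apply: hom_zero_of_tot_acyclic].
Qed.

End Sign.

Theorem theorem6p6 (k : fieldType) :
  (connectively_induces (std_tstructure k) (C_plus k) /\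
   bounded_tstructure (C_plus k) (conn_induced (std_tstructure k) (C_plus k)))
  /\
  (connectively_induces (std_tstructure k) (C_minus k) /\
   bounded_tstructure (C_minus k) (conn_induced (std_tstructure k) (C_minus k))).
Proof.
split; split.
- exact: (connectively_induces_orth (left_orthP (k := k) true)).
- exact: (bounded_orth (left_orthP (k := k) true)).
- exact: (connectively_induces_orth (left_orthP (k := k) false)).
- exact: (bounded_orth (left_orthP (k := k) false)).
Qed.
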